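(* Let $\mathcal M=(M,<,\ldots)$ be a definably complete locally o-minimal structure and let $X$ be a definable set (a definable subset of $M^n$ for some $n$). Then $\dim X=\operatorname{D}(X)$, where $\operatorname{D}(X)$ is the dimension rank of $X$.
   Context: ''Definable'' means definable in the given structure with parameters. Let $\mathcal M=(M,<,\ldots)$ be an expansion of a dense linear order without endpoints; $M$ carries the order topology and $M^n$ the product topology. $M^0$ is a singleton with the trivial topology; a projection $M^n\to M^0$ is the trivial map, and the nonempty open box in $M^0$ is $M^0$ itself. An open interval is a nonempty set $(a,b)=\{x\in M : a<x<b\}$ with $a,b\in M\cup\{\pm\infty\}$. $\mathcal M$ is locally o-minimal if, for every definable subset $X$ of $M$ and every $a\in M$, there exists an open interval $I$ containing $a$ such that $X\cap I$ is a finite union of points and open intervals. $\mathcal M$ is definably complete if every definable subset of $M$ has a supremum and an infimum in $M\cup\{\pm\infty\}$. Dimension: for a nonempty definable subset $X$ of $M^n$, $\dim X$ is the maximal nonnegative integer $d$ such that $\pi(X)$ has nonempty interior for some coordinate projection $\pi:M^n\to M^d$; $\dim\emptyset=-\infty$. Dimension rank: $\mathcal M$ is a first-order topological structure with respect to the order topology (a basis of the topology is uniformly definable), and in a definably complete locally o-minimal structure every definable set is constructible, i.e. a finite boolean combination of open sets. For a definable set $X$, the ordinal-valued dimension rank $\operatorname{D}(X)$ is defined as follows: (1) if $X$ is nonempty, then $\operatorname{D}(X)\ge 0$; otherwise $\operatorname{D}(X)=-\infty$; (2) if $\operatorname{D}(X)\ge\alpha$ for all $\alpha<\delta$, where $\delta$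 is a limit ordinal, then $\operatorname{D}(X)\ge\delta$; (3) $\operatorname{D}(X)\ge\alpha+1$ if there exists a definable closed subset $Y$ of $X$ (closed in the subspace topology of $X$) such that $Y$ has empty interior in $X$ and $\operatorname{D}(Y)\ge\alpha$. Put $\operatorname{D}(X)=\alpha$ if $\operatorname{D}(X)\ge\alpha$ and $\operatorname{D}(X)\not\ge\alpha+1$, and $\operatorname{D}(X)=\infty$ if $\operatorname{D}(X)\ge\alpha$ for all ordinals $\alpha$. *)

(* Defs.v *)
From mathcomp Require Export all_boot all_order all_classical.
From mathcomp Require Export topology.

Set Implicit Arguments.
Unset Strict Implicit.
Unset Printing Implicit Defensive.

Local Open Scope order_scope.
Local Open Scope classical_set_scope.

(* M^n with the product topology *)
Notation cart M n := {ptws 'I_n -> M} (only parsing).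

(* The symbols of the language other than < and =. *)
Record language := Language {
  fun_symb : nat -> Type;
  rel_symb : nat -> Type }.

Record structure (L : language) (M : Type) := Structure {
  fun_interp : forall k, fun_symb L k -> ('I_k -> M) -> M;
  rel_interp : forall k, rel_symb L k -> ('I_k -> M) -> Prop }.

(* Terms with free variables indexed by 'I_n and parameters from M. *)
Inductive term (L : language) (M : Type) (n : nat) : Type :=
| TVar of 'I_n
| TPar of M
| TApp (k : nat) (f : fun_symb L k) (ts : 'I_k -> term L M n).

(* [FEx] binds the variable ord0 of its body; the free variable i of
   [FEx p] is the variable [lift ord0 i] of p. *)
Inductive formula (L : language) (M : Type) : nat -> Type :=
| FEq n (t u : term L M n) : formula L M n
| FLt n (t u : term L M n) : formula L M n
| FRel n (k : nat) (r : rel_symb L k) (ts : 'I_k -> term L M n) : formula L M n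
| FNot n (p : formula L M n) : formula L M n
| FAnd n (p q : formula L M n) : formula L M n
| FEx n (p : formula L M n.+1) : formula L M n.

Definition env_cons (M : Type) (n : nat) (a : M) (x : 'I_n -> M)
    (i : 'I_n.+1) : M :=
  if unlift ord0 i is Some j then x j else a.

Section Definability.
Context (L : language) {disp : Order.disp_t} {M : orderTopologicalType disp}.
Variable S : structure L M.

Fixpoint teval n (x : 'I_n -> M) (t : term L M n) : M :=
  match t with
  | TVar i => x i
  | TPar a => a
  | TApp k f ts => fun_interp S f (fun i => teval x (ts i))
  end.

Fixpoint holds n (p : formula L M n) : ('I_n -> M) -> Prop :=
  match p with
  | FEq _ t u => fun x => teval x t = teval x u
  | FLt _ t u => fun x => teval x t < teval x u
  | FRel _ k r ts => fun x => rel_interp S r (fun i => teval x (ts i))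
  | FNot _ q => fun x => ~ holds q x
  | FAnd _ q r => fun x => holds q x /\ holds r x
  | FEx _ q => fun x => exists a : M, holds q (env_cons a x)
  end.

Definition definable n (X : set (cart M n)) : Prop :=
  exists p : formula L M n, X = [set x | holds p x].

Definition definable1 (X : set M) : Prop :=
  definable ([set x | X (x ord0)] : set (cart M 1)).

End Definability.

Definition DLO_without_endpoints {disp} (M : orderType disp) : Prop :=
  (forall x y : M, x < y -> exists z, x < z < y) /\
  (forall x : M, (exists y, y < x) /\ (exists y, x < y)).

Variant endpoint (M : Type) : Type := NInf | Fin of M | PInf.
Arguments NInf {M}.
Arguments PInf {M}.

Section Tameness.
Context (L : language) {disp : Order.disp_t} {M : orderTopologicalType disp}.

Definition ep_le (a b : endpoint M) : bool :=
  match a, b with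
  | NInf, _ | _, PInf => true
  | Fin x, Fin y => x <= y
  | _, _ => false
  end.

Definition ep_lt (a b : endpoint M) : bool := ~~ ep_le b a.

Definition open_interval (I : set M) : Prop :=
  I !=set0 /\ exists a b, I = [set x | ep_lt a (Fin x) /\ ep_lt (Fin x) b].

Definition is_supremum (X : set M) (s : endpoint M) : Prop :=
  (forall x, X x -> ep_le (Fin x) s) /\
  (forall t, (forall x, X x -> ep_le (Fin x) t) -> ep_le s t).

Definition is_infimum (X : set M) (s : endpoint M) : Prop :=
  (forall x, X x -> ep_le s (Fin x)) /\
  (forall t, (forall x, X x -> ep_le t (Fin x)) -> ep_le t s).

Variable S : structure L M.

Definition definably_complete : Prop :=
  forall X : set M, definable1 S X ->
    (exists s, is_supremum X s) /\ (exists s, is_infimum X s).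

Definition locally_o_minimal : Prop :=
  forall X : set M, definable1 S X -> forall a : M,
  exists I : set M, [/\ open_interval I, I a &
    exists (k : nat) (F : 'I_k -> set M),
      (forall i, (exists b, F i = [set b]) \/ open_interval (F i)) /\
      X `&` I = \bigcup_i F i].

End Tameness.

Section Dimension.
Context {disp : Order.disp_t} {M : orderTopologicalType disp}.

Definition coord_proj d n (s : 'I_d -> 'I_n) (x : cart M n) : cart M d :=
  fun i => x (s i).

Definition has_open_proj n (X : set (cart M n)) (d : nat) : Prop :=
  exists s : 'I_d -> 'I_n, {homo s : i j / (i < j)%N} /\
    @interior (cart M d) (coord_proj s @` X) !=set0.

(* [None] stands for -oo.  Only d <= n can occur, and d = 0 does occur when X
   is nonempty. *)
Definition dim n (X : set (cart M n)) : option nat :=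
  if `[< X !=set0 >] then Some (\max_(d < n.+1 | `[< has_open_proj X d >]) d)%N
  else None.

End Dimension.

(* [Ord f] denotes the least ordinal greater than all the [f i].  Distinct
   trees may denote the same ordinal: equality of ordinals is [oeq]. *)
Inductive ord : Type := Ord (I : Type) (f : I -> ord).

Fixpoint ole (a b : ord) : Prop :=
  let: Ord _ f := a in let: Ord _ g := b in
  forall i, exists j, ole (f i) (g j).

Definition olt (a b : ord) : Prop :=
  let: Ord _ g := b in exists j, ole a (g j).

Definition oeq (a b : ord) : Prop := ole a b /\ ole b a.

Definition ozero : ord := Ord (fun e : Empty_set => match e with end).

Definition osucc (a : ord) : ord := Ord (fun _ : unit => a).

Definition olimit (a : ord) : Prop :=
  ~ oeq a ozero /\ forall b, ~ oeq a (osucc b).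

Definition onat (d : nat) : ord := iter d osucc ozero.

Variant xord : Type := ONInf | OFin of ord | OInf.

Definition xord_of_dim (d : option nat) : xord :=
  if d is Some k then OFin (onat k) else ONInf.

Section DimensionRank.
Context (L : language) {disp : Order.disp_t} {M : orderTopologicalType disp}.
Variable S : structure L M.

(* [drank_ge a X] is D(X) >= a *)
Inductive drank_ge n : ord -> set (cart M n) -> Prop :=
| drank_ge_zero a (X : set (cart M n)) :
    oeq a ozero -> X !=set0 -> drank_ge a X
| drank_ge_limit a (X : set (cart M n)) :
    olimit a -> (forall b, olt b a -> drank_ge b X) -> drank_ge a X
| drank_ge_succ a b (X Y : set (cart M n)) :
    oeq a (osucc b) -> definable S Y -> Y `<=` X ->
    @closed (subspace X) Y -> @interior (subspace X) Y = set0 ->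
    drank_ge b Y -> drank_ge a X.

(* [drank_is X v] is D(X) = v; an ordinal v is determined up to [oeq]. *)
Definition drank_is n (X : set (cart M n)) (v : xord) : Prop :=
  match v with
  | ONInf => X = set0
  | OFin a => drank_ge a X /\ ~ drank_ge (osucc a) X
  | OInf => forall a, drank_ge a X
  end.

End DimensionRank.

(* Main.v *)
Require Import Defs.
From mathcomp Require Import interval zify.

(* Call a subset of M^d large if it contains an open box.  The key fact is that
   if R is a definable family of subsets of M, indexed by a box of M^k, whose
   members all contain an interval, then a single interval is contained in R_u
   for all u in some smaller box.  For k = 1 this follows from a one-sided
   semicontinuity property of definable functions M -> M; the inductive step
   applies the case k = 1 to one variable and then makes the endpoints of the
   box obtained uniform in the other variables, one endpoint at a time.  It
   replaces cell decomposition and definable choice: any datum (a box isolating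
   a point, a box witnessing relative interiority) which may be chosen with its
   coordinates ranging over intervals can be chosen constant on a smaller box.
   Hence every definable subset of a box is large or has a large complement.
   If Y is a subset of X and both have dimension d, then over some box of M^d
   the fibres of X are discrete, a constant box isolates in every fibre of X a
   point of Y, and so Y has interior in X; thus D(X) <= dim X.  Conversely, if X
   projects onto a box of M^(d+1), intersect X with a generic hyperplane
   x_i = c and remove the interior relative to X: this is closed and nowhere
   dense in X and still projects onto a box of M^d. *)

Set Implicit Arguments.
Unset Strict Implicit.
Unset Printing Implicit Defensive.

Import Order.TTheory.
Local Open Scope order_scope.
Local Open Scope classical_set_scope.

(** * Definability in infinite environments *)

Section Formulas.
Context (L : language) {disp : Order.disp_t} {M : orderTopologicalType disp}.
Variable S : structure L M.

Fixpoint tsubst n m (s : 'I_n -> term L M m) (t : term L M n) : term L M m :=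
  match t with
  | TVar i => s i
  | TPar a => TPar L m a
  | TApp k f ts => TApp f (fun i => tsubst s (ts i))
  end.

Lemma teval_tsubst n m (s : 'I_n -> term L M m) t x :
  teval S x (tsubst s t) = teval S (fun i => teval S x (s i)) t.
Proof.
by elim: t => //= k f ts IH; congr fun_interp; apply: funext => i; apply: IH.
Qed.

Definition lift_subst n m (s : 'I_n -> term L M m) (i : 'I_n.+1) :
    term L M m.+1 :=
  if unlift ord0 i is Some j then tsubst (fun l => TVar L M (lift ord0 l)) (s j)
  else TVar L M ord0.

Lemma env_cons0 (T : Type) n (a : T) (x : 'I_n -> T) : env_cons a x ord0 = a.
Proof. by rewrite /env_cons unlift_none. Qed.

Lemma env_cons_lift (T : Type) n (a : T) (x : 'I_n -> T) i :
  env_cons a x (lift ord0 i) = x i.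
Proof. by rewrite /env_cons liftK. Qed.

(** Induction on the formula with [s] general: under a quantifier it becomes [lift_subst s], which
    fixes the bound variable. *)
Lemma holds_subst n (p : formula L M n) m (s : 'I_n -> term L M m) :
  exists q : formula L M m,
    forall x, holds S q x <-> holds S p (fun i => teval S x (s i)).
Proof.
elim: p m s => {n} [n t u|n t u|n k r ts|n p IH|n p IHp q IHq|n p IH] m s.
- by exists (FEq (tsubst s t) (tsubst s u)) => x /=; rewrite !teval_tsubst.
- by exists (FLt (tsubst s t) (tsubst s u)) => x /=; rewrite !teval_tsubst.
- exists (FRel r (fun i => tsubst s (ts i))) => x /=.
  by under [X in rel_interp _ _ X]funext => i do rewrite teval_tsubst.
- by have [q qP] := IH m s; exists (FNot q) => x /=; rewrite qP.
- have [p' pP] := IHp m s; have [q' qP] := IHq m s.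
  by exists (FAnd p' q') => x /=; rewrite pP qP.
- have [q qP] := IH m.+1 (lift_subst s).
  exists (FEx q) => x /=.
  have E a : (fun i => teval S (env_cons a x) (lift_subst s i)) =
             env_cons a (fun i => teval S x (s i)).
    apply: funext => i; rewrite /lift_subst; case: (unliftP ord0 i) => [j ->|->].
      rewrite teval_tsubst env_cons_lift; congr (teval S _ _).
      by apply: funext => l /=; rewrite env_cons_lift.
    by rewrite /= !env_cons0.
  by split=> -[a]; [move/qP; rewrite E|rewrite -E => /qP]; exists a.
Qed.

(* Environments are infinite so that variables can be renamed and quantifiers
   added without any arithmetic on arities. *)
Definition edefinable (P : (nat -> M) -> Prop) : Prop :=
  exists N (p : formula L M N), forall e, P e <-> holds S p (fun i => e i).

Lemma edefinable_iff (P Q : (nat -> M) -> Prop) :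
  (forall e, P e <-> Q e) -> edefinable P -> edefinable Q.
Proof.
by move=> PQ [N [p pP]]; exists N, p => e; rewrite -PQ.
Qed.

Lemma edefinable_widen (P : (nat -> M) -> Prop) : edefinable P ->
  exists N, forall N', (N <= N')%N ->
    exists p : formula L M N', forall e, P e <-> holds S p (fun i => e i).
Proof.
move=> [N [p pP]]; exists N => N' NN'.
have [q qP] := holds_subst p (fun i => TVar L M (widen_ord NN' i)).
by exists q => e; rewrite pP qP.
Qed.

Lemma edefinable_not (P : (nat -> M) -> Prop) : edefinable P -> edefinable (fun e => ~ P e).
Proof. by move=> [N [p pP]]; exists N, (FNot p) => e; rewrite pP. Qed.

Lemma edefinable_and (P Q : (nat -> M) -> Prop) :
  edefinable P -> edefinable Q -> edefinable (fun e => P e /\ Q e).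
Proof.
move=> /edefinable_widen[N HP] /edefinable_widen[N' HQ].
have [p pP] := HP (maxn N N') (leq_maxl _ _).
have [q qP] := HQ (maxn N N') (leq_maxr _ _).
by exists (maxn N N'), (FAnd p q) => e; rewrite pP qP.
Qed.

Lemma edefinable_or (P Q : (nat -> M) -> Prop) :
  edefinable P -> edefinable Q -> edefinable (fun e => P e \/ Q e).
Proof.
move=> dP dQ; have /edefinable_not := edefinable_and (edefinable_not dP) (edefinable_not dQ).
by apply: edefinable_iff => e; split=> [/not_andP[/contrapT|/contrapT]|[]]; tauto.
Qed.

Lemma edefinable_imp (P Q : (nat -> M) -> Prop) :
  edefinable P -> edefinable Q -> edefinable (fun e => P e -> Q e).
Proof.
move=> dP dQ; apply: edefinable_iff (edefinable_or (edefinable_not dP) dQ) => e.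
by split=> [[]//|PQ]; have [/PQ|] := pselect (P e); [right|left].
Qed.

Lemma edefinable_ex (Q : M -> (nat -> M) -> Prop) :
  edefinable (fun e => Q (e 0) (fun j => e j.+1)) -> edefinable (fun e => exists a, Q a e).
Proof.
move=> /edefinable_widen[N H]; have [p pP] := H N.+1 (leqnSn N).
exists N, (FEx p) => e /=.
suff E a : Q a e <-> holds S p (env_cons a (fun i : 'I_N => e i)).
  by split=> -[a] /E; exists a.
have := pP (fun j => if j is i.+1 then e i else a); rewrite /= => ->.
suff -> : env_cons a (fun i : 'I_N => e i) =
  (fun i : 'I_N.+1 => if val i is i'.+1 then e i' else a) by [].
apply: funext => i; case: (unliftP ord0 i) => [j ->|->].
  by rewrite env_cons_lift.
by rewrite env_cons0.
Qed.

Lemma edefinable_all (Q : M -> (nat -> M) -> Prop) :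
  edefinable (fun e => Q (e 0) (fun j => e j.+1)) -> edefinable (fun e => forall a, Q a e).
Proof.
move=> /edefinable_not/(@edefinable_ex (fun a e => ~ Q a e))/edefinable_not.
apply: edefinable_iff => e.
by split=> [H a|H [a]]; [apply: contrapT => nQ; apply: H; exists a|apply].
Qed.

Lemma edefinable_simple_subst (P : (nat -> M) -> Prop) (t : nat -> nat + M) :
  edefinable P -> edefinable (fun e => P (fun j => match t j with inl k => e k | inr a => a end)).
Proof.
move=> [N [p pP]].
pose K := (\max_(i < N) (if t i is inl k then k else 0)).+1%N.
have tK (i : 'I_N) k : t i = inl k -> (k < K)%N.
  move=> tik; rewrite ltnS; apply: leq_trans (leq_bigmax i).
  by rewrite tik.
pose s (i : 'I_N) : term L M K :=
  match t i with inl k => TVar L M (inord k) | inr a => TPar L K a end.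
have [q qP] := holds_subst p s.
exists K, q => e; rewrite pP qP.
suff -> : (fun i : 'I_N => match t i with inl k => e k | inr a => a end) =
          (fun i => teval S (fun j : 'I_K => e j) (s i)) by [].
apply: funext => i; rewrite /s; case E: (t i) => [k|a] //=.
by rewrite inordK //; apply: tK E.
Qed.

Lemma edefinable_rename (P : (nat -> M) -> Prop) (r : nat -> nat) :
  edefinable P -> edefinable (fun e => P (fun j => e (r j))).
Proof. exact: (@edefinable_simple_subst P (fun j => inl (r j))). Qed.

(** Graphs are used rather than terms, so as to admit functions such as infima of definable
    families. *)
Definition efun (f : (nat -> M) -> M) : Prop :=
  edefinable (fun e => e 0 = f (fun j => e j.+1)).

Lemma efun_var k : efun (fun e => e k).
Proof. by exists k.+2, (FEq (TVar L M ord0) (TVar L M ord_max)). Qed.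

Lemma efun_const a : efun (fun _ => a).
Proof. by exists 1, (FEq (TVar L M ord0) (TPar L 1 a)). Qed.

Lemma efun_rename f (r : nat -> nat) : efun f -> efun (fun e => f (fun j => e (r j))).
Proof.
move=> /(@edefinable_rename _ (fun j => if j is i.+1 then (r i).+1 else 0)).
exact: edefinable_iff.
Qed.

Lemma edefinable_dep (P : (nat -> M) -> Prop) : edefinable P ->
  exists N, forall e e', (forall i, (i < N)%N -> e i = e' i) -> P e <-> P e'.
Proof.
move=> [N [p pP]]; exists N => e e' ee'; rewrite !pP.
suff -> : (fun i : 'I_N => e i) = (fun i : 'I_N => e' i) by [].
by apply: funext => i; apply: ee'.
Qed.

Lemma edefinable_subst (P : (nat -> M) -> Prop) (t : nat -> (nat -> M) -> M) :
  edefinable P -> (forall j, efun (t j)) -> edefinable (fun e => P (fun j => t j e)).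
Proof.
(* [cat K] puts the first [K] values of [v] in front of [e]. Induction on [K] substitutes one
   variable at a time, at the cost of a quantifier, and by [edefinable_dep] some finite [K] covers
   all variables that matter. *)
pose cat K (v e : nat -> M) j := if (j < K)%N then v j else e (j - K)%N.
have H K : forall t : nat -> (nat -> M) -> M, edefinable P -> (forall j, efun (t j)) ->
    edefinable (fun e => P (cat K (fun j => t j e) e)).
  elim: K => [|K IH] u dP du.
    apply: edefinable_iff dP => e; suff -> : cat 0 (fun j => u j e) e = e by [].
    by apply: funext => j; rewrite /cat ltn0 subn0.
  have H := edefinable_and (du K) (IH (fun j e => u j (fun i => e i.+1)) dP
    (fun j => efun_rename succn (du j))).
  pose scons y (e : nat -> M) i := if i is i'.+1 then e i' else y.
  have {}H : edefinable (fun e => exists y, y = u K e /\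
      P (cat K (fun j => u j e) (scons y e))).
    apply: (@edefinable_ex (fun y e => y = u K e /\ P (cat K (u^~ e) (scons y e)))).
    apply: edefinable_iff H => e; suff -> : scons (e 0) (fun j => e j.+1) = e by [].
    by apply: funext => -[].
  apply: edefinable_iff H => e.
  have E : cat K (u^~ e) (scons (u K e) e) = cat K.+1 (u^~ e) e.
    apply: funext => j; rewrite /cat ltnS.
    case: (ltngtP j K) => [//|Kj|->]; last by rewrite subnn.
    by have -> : (j - K = (j - K.+1).+1)%N by lia.
  by split=> [[y [->]]|]; rewrite -E // => He; exists (u K e).
move=> dP dt; have [N NP] := edefinable_dep dP.
apply: edefinable_iff (H N t dP dt) => e; apply: NP => i iN.
by rewrite /cat iN.
Qed.

Lemma edefinable_eq f g : efun f -> efun g -> edefinable (fun e => f e = g e).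
Proof.
move=> df dg; have := edefinable_and df dg.
move=> /(@edefinable_ex (fun y e => y = f e /\ y = g e)); apply: edefinable_iff => e.
by split=> [[y [<-]]//|fg]; exists (f e).
Qed.

Lemma edefinable_lt f g : efun f -> efun g -> edefinable (fun e => (f e < g e)%O).
Proof.
move=> df dg.
pose t j := if j is 0 then f else g.
apply: (@edefinable_subst (fun e => (e 0 < e 1)%O) t); last by case.
by exists 2, (FLt (TVar L M ord0) (TVar L M ord_max)).
Qed.

Lemma edefinable_exv k (Q : ('I_k -> M) -> (nat -> M) -> Prop) :
  edefinable (fun e => Q (fun i => e i) (fun j => e (k + j))) ->
  edefinable (fun e => exists v, Q v e).
Proof.
elim: k Q => [|k IH] Q dQ.
  apply: edefinable_iff dQ => e; split=> [?|[v Qv]]; first by exists (fun i : 'I_0 => e i).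
  suff -> : (fun i : 'I_0 => e i) = v by [].
  by apply: funext => -[].
pose Q' v a e := Q (env_cons a v) e.
have {dQ} : edefinable (fun e => exists a, exists v, Q' v a e).
  apply: (@edefinable_ex (fun a e => exists v, Q' v a e)).
  apply: (IH (fun v e => Q' v (e 0) (fun j => e j.+1))).
  (* The quantifiers put [v] at positions 0 to k-1 and [a] at position k, whereas [dQ] expects [a]
     first. *)
  move: dQ => /(@edefinable_rename _
    (fun j => if (j == 0)%N then k else if (j <= k)%N then j.-1 else j)).
  apply: edefinable_iff => e; rewrite /Q'.
  set v := fun i : 'I_k.+1 => _; set v' := env_cons _ _.
  have -> : v = v'.
    apply: funext => i; rewrite /v /v'; case: (unliftP ord0 i) => [j ->|->].
      by rewrite env_cons_lift lift0 /= ltn_ord.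
    by rewrite env_cons0 /= addn0.
  set w := fun j : nat => _; set w' := fun j : nat => _.
  suff -> : w = w' by [].
  apply: funext => j; rewrite /w /w' addSn /= addnS.
  by case: leqP => //; lia.
apply: edefinable_iff => e; split=> [[a [v]]|[v Qv]]; first by exists (env_cons a v).
exists (v ord0), (fun i => v (lift ord0 i)); rewrite /Q'.
suff -> : env_cons (v ord0) (fun i => v (lift ord0 i)) = v by [].
apply: funext => i; case: (unliftP ord0 i) => [j ->|->].
  by rewrite env_cons_lift.
by rewrite env_cons0.
Qed.

Lemma edefinable_allv k (Q : ('I_k -> M) -> (nat -> M) -> Prop) :
  edefinable (fun e => Q (fun i => e i) (fun j => e (k + j))) ->
  edefinable (fun e => forall v, Q v e).
Proof.
move=> /edefinable_not/(@edefinable_exv _ (fun a e => ~ Q a e))/edefinable_not.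
apply: edefinable_iff => e.
by split=> [H a|H [a]]; [apply: contrapT => nQ; apply: H; exists a|apply].
Qed.

Lemma edefinable_true : edefinable (fun _ => True).
Proof. exact: edefinable_iff (edefinable_eq (efun_var 0) (efun_var 0)). Qed.

Lemma edefinable_all_fin (I : finType) (Q : I -> (nat -> M) -> Prop) :
  (forall i, edefinable (Q i)) -> edefinable (fun e => forall i, Q i e).
Proof.
move=> dQ; suff H (s : seq I) : edefinable (fun e => forall i, i \in s -> Q i e).
  apply: edefinable_iff (H (enum I)) => e.
  by split=> He i *; apply: He; rewrite ?mem_enum.
elim: s => [|i s IH]; first by apply: edefinable_iff edefinable_true => e; split.
apply: edefinable_iff (edefinable_and (dQ i) IH) => e; split=> [[Qi Qs] j|H].
  by rewrite inE => /orP[/eqP->//|]; apply: Qs.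
by split=> [|j js]; apply: H; rewrite inE ?eqxx// js orbT.
Qed.

Lemma efun_env_cons k (t : (nat -> M) -> M) (v : (nat -> M) -> 'I_k -> M) i :
  efun t -> (forall j, efun (fun e => v e j)) -> efun (fun e => env_cons (t e) (v e) i).
Proof.
move=> dt dv; case: (unliftP ord0 i) => [j ->|->]; rewrite /env_cons.
  by rewrite liftK.
by rewrite unlift_none.
Qed.

(** This and the next notions are phrased as stability under substitution of definable functions, so
    that [dfn] can decompose a goal along its syntax. *)
Definition definable_vpred k (X : ('I_k -> M) -> Prop) : Prop :=
  forall v : (nat -> M) -> 'I_k -> M, (forall i, efun (fun e => v e i)) ->
  edefinable (fun e => X (v e)).

Definition definable_pred (X : M -> Prop) : Prop :=
  forall f, efun f -> edefinable (fun e => X (f e)).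

Definition definable_rel (R : M -> M -> Prop) : Prop :=
  forall f g, efun f -> efun g -> edefinable (fun e => R (f e) (g e)).

Definition definable_fun (h : M -> M) : Prop := forall f, efun f -> efun (fun e => h (f e)).

Definition definable_family k (R : ('I_k -> M) -> M -> Prop) : Prop :=
  forall v f, (forall i, efun (fun e => v e i)) -> efun f ->
  edefinable (fun e => R (v e) (f e)).

Definition definable_vfamily k n (R : ('I_k -> M) -> ('I_n -> M) -> Prop) : Prop :=
  forall v w, (forall i, efun (fun e => v e i)) -> (forall i, efun (fun e => w e i)) ->
  edefinable (fun e => R (v e) (w e)).

Definition definable_family2 k (R : ('I_k -> M) -> M -> M -> Prop) : Prop :=
  forall v f g, (forall i, efun (fun e => v e i)) -> efun f -> efun g ->
  edefinable (fun e => R (v e) (f e) (g e)).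

Lemma definable_definable_vpred n (X : set (cart M n)) : definable S X -> definable_vpred X.
Proof.
move=> [p ->] v dv.
pose t j e := if insub j is Some i then v e i else e j.
have dt j : efun (t j) by rewrite /t; case: insub => [i|] //; apply: efun_var.
have dp : edefinable (fun e => holds S p (fun i : 'I_n => e i)) by exists n, p.
apply: edefinable_iff (edefinable_subst dp dt) => e /=.
suff -> : (fun i : 'I_n => t i e) = v e by [].
by apply: funext => i; rewrite /t valK.
Qed.

(* The point of [M] is needed for the parameters replacing dummy variables. *)
Lemma definable_vpred_definable n (X : set (cart M n)) : M -> definable_vpred X -> definable S X.
Proof.
move=> a dX.
have [N [p pP]] := dX (fun e i => e i) (fun i => efun_var i).
pose s (i : 'I_N) : term L M n :=
  if insub (val i) is Some j then TVar L M j else TPar L n a.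
have [q qP] := holds_subst p s.
exists q; apply/funext => x; apply: propext => /=; rewrite qP.
have := pP (fun j => if insub j is Some i then x i else a).
have -> : (fun i : 'I_n => if insub (val i) is Some i then x i else a) = x.
  by apply: funext => i; rewrite valK.
move=> ->.
suff -> : (fun i : 'I_N => if insub (val i) is Some i then x i else a) =
  (fun i => teval S x (s i)) by [].
by apply: funext => i; rewrite /s; case: insub.
Qed.

Lemma definable_pred_definable1 (X : set M) : definable_pred X -> M -> definable1 S X.
Proof. by move=> dX a; apply: definable_vpred_definable => // v dv; apply: dX. Qed.

Lemma graph_definable_fun (R : M -> M -> Prop) (h : M -> M) :
  definable_rel R -> (forall x y, R x y <-> y = h x) -> definable_fun h.
Proof.
move=> dR Rh f df; rewrite /efun.
by apply: edefinable_iff (dR _ _ (efun_rename succn df) (efun_var 0)) => e; apply: Rh.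
Qed.

End Formulas.

(** * Syntax-directed proofs of definability *)

Ltac dfn_term :=
  match goal with
  | |- efun _ (fun e => e _) => apply: efun_var
  | |- efun _ (fun e => ?a) => apply: efun_const
  | H : efun _ ?f |- efun _ ?f => exact: H
  | H : efun _ ?f |- efun _ (fun e => ?f _) => exact: (efun_rename _ H)
  | H : forall i, efun _ (fun e => ?v e i) |- efun _ (fun e => ?v e _) => exact: H
  | H : forall i, efun _ (fun e => ?v e i) |- efun _ (fun e => ?v _ _) =>
      exact: (efun_rename _ (H _))
  | H : definable_fun _ ?h |- efun _ (fun e => ?h _) => refine (H _ _)
  | |- efun _ (fun e => env_cons _ _ _) => apply: efun_env_cons
  end.

Ltac dfn_step :=
  cbv beta;
  match goal with
  | |- efun _ _ => dfn_term
  | |- forall _, edefinable _ _ => let i := fresh "i" in intro i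
  | |- forall _ : 'I__, efun _ _ => let i := fresh "i" in intro i
  | H : definable_pred _ ?X |- edefinable _ (fun e => ?X _) => refine (H _ _)
  | H : definable_rel _ ?X |- edefinable _ (fun e => ?X _ _) => refine (H _ _ _ _)
  | H : definable_vpred _ ?X |- edefinable _ (fun e => ?X _) => refine (H _ _)
  | H : definable_family _ ?X |- edefinable _ (fun e => ?X _ _) => refine (H _ _ _ _)
  | H : definable_family2 _ ?X |- edefinable _ (fun e => ?X _ _ _) => refine (H _ _ _ _ _ _)
  | H : definable_vfamily _ ?X |- edefinable _ (fun e => ?X _ _) => refine (H _ _ _ _)
  | |- edefinable _ (fun e => _ /\ _) => apply: edefinable_and
  | |- edefinable _ (fun e => _ \/ _) => apply: edefinable_or
  | |- edefinable _ (fun e => ~ _) => apply: edefinable_not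
  | |- edefinable _ (fun e => _ = _) => apply: edefinable_eq
  | |- edefinable _ (fun e => is_true (Order.lt _ _)) => apply: edefinable_lt
  | |- edefinable _ (fun e => exists v : 'I_?k -> _, @?Q e v) =>
      refine (@edefinable_exv _ _ _ _ _ (fun v e => Q e v) _)
  | |- edefinable _ (fun e => exists a, @?Q e a) =>
      refine (@edefinable_ex _ _ _ _ (fun a e => Q e a) _)
  | |- edefinable _ (fun e => _ -> _) => apply: edefinable_imp
  | |- edefinable _ (fun e => forall v : 'I_?k -> _, @?Q e v) =>
      refine (@edefinable_allv _ _ _ _ _ (fun v e => Q e v) _)
  | |- edefinable _ (fun e => forall i : 'I_?k, @?Q e i) =>
      refine (@edefinable_all_fin _ _ _ _ _ (fun i e => Q e i) _)
  | |- edefinable _ (fun e => forall a, @?Q e a) =>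
      refine (@edefinable_all _ _ _ _ (fun a e => Q e a) _)
  end.

Ltac dfn := repeat intro; repeat dfn_step.

(** * Definable functions of one variable *)

Section OneVariable.
Context (L : language) {disp : Order.disp_t} {M : orderTopologicalType disp}.
Variable S : structure L M.

Local Notation definable_pred := (definable_pred S).
Local Notation definable_rel := (definable_rel S).

(* The properties of the order used in one variable; they are invariant under
   reversing it, which halves the number of cases below. *)
Record tame_order (lt : M -> M -> Prop) : Prop := TameOrder {
  to_irr : forall x, ~ lt x x;
  to_trans : forall y x z, lt x y -> lt y z -> lt x z;
  to_total : forall x y, lt x y \/ x = y \/ lt y x;
  to_dense : forall x y, lt x y -> exists z, lt x z /\ lt z y;
  to_above : forall x, exists y, lt x y;
  to_below : forall x, exists y, lt y x;
  to_def : definable_rel lt;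
  to_germr : forall X a, definable_pred X -> exists b, lt a b /\
    ((forall x, lt a x -> lt x b -> X x) \/ (forall x, lt a x -> lt x b -> ~ X x));
  to_germl : forall X b, definable_pred X -> exists a, lt a b /\
    ((forall x, lt a x -> lt x b -> X x) \/ (forall x, lt a x -> lt x b -> ~ X x));
  to_sup : forall X, definable_pred X -> (exists x, X x) -> forall c, (forall x, X x -> ~ lt c x) ->
    exists m, (forall x, X x -> ~ lt m x) /\
      forall c, (forall x, X x -> ~ lt c x) -> ~ lt c m;
  to_inf : forall X, definable_pred X -> (exists x, X x) -> forall c, (forall x, X x -> ~ lt x c) ->
    exists m, (forall x, X x -> ~ lt x m) /\
      forall c, (forall x, X x -> ~ lt x c) -> ~ lt m c }.

Definition rev_lt (lt : M -> M -> Prop) : M -> M -> Prop := fun x y => lt y x.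

Lemma tame_rev lt : tame_order lt -> tame_order (rev_lt lt).
Proof.
case=> irr tr tot dn ab be df gr gl su in_; split=> //.
- by move=> y x z yx zy; apply: tr zy yx.
- by move=> x y; have [] := tot x y; tauto.
- by move=> x y /dn[z [? ?]]; exists z.
- by move=> f g dF dG; apply: df.
- move=> X a /(gl X a)[b [ba H]]; exists b; split=> //.
  by case: H => H; [left|right] => x ? ?; apply: H.
- move=> X a /(gr X a)[b [ba H]]; exists b; split=> //.
  by case: H => H; [left|right] => x ? ?; apply: H.
Qed.

End OneVariable.

(** * Deciding order goals over an abstract tame order *)

Ltac ord_subst lt E :=
  lazymatch type of E with ?x = ?y =>
    first [subst x | subst y |
      repeat match goal with
      | H : lt x _ |- _ => rewrite E in H
      | H : lt _ x |- _ => rewrite E in H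
      | H : ~ lt x _ |- _ => rewrite E in H
      | H : ~ lt _ x |- _ => rewrite E in H
      end; clear E]
  end.

Ltac ord T :=
  lazymatch type of T with tame_order _ ?lt =>
  try (intro);
  try match goal with |- lt ?x ?y =>
    let H := fresh in destruct (to_total T x y) as [H|[H|H]];
    [exact H|ord_subst lt H|]; exfalso end;
  repeat match goal with
  | H : lt ?x ?x |- _ => case (to_irr T H)
  | H : ~ lt ?x ?x |- _ => clear H
  | H : ~ lt ?x ?y |- _ =>
    let H1 := fresh in
    destruct (to_total T x y) as [H1|[H1|H1]];
    [case (H H1)|clear H; ord_subst lt H1|clear H] end;
  repeat match goal with
  | H : lt ?x ?x |- _ => case (to_irr T H)
  | H1 : lt ?x ?y, H2 : lt ?y ?z |- _ =>
    lazymatch goal with H : lt x z |- _ => fail | _ =>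
    let H := fresh in have H : lt x z := to_trans T H1 H2 end
  end end.

Section OneVariable.
Context (L : language) {disp : Order.disp_t} {M : orderTopologicalType disp}.
Variable S : structure L M.

Local Notation definable_pred := (definable_pred S).
Local Notation definable_rel := (definable_rel S).
Local Notation tame_order := (tame_order S).

(** One-sided germs; the left-hand version is [near_r (rev_lt lt)]. *)
Definition near_r (lt : M -> M -> Prop) (P : M -> Prop) (c : M) : Prop :=
  exists e, lt c e /\ forall t, lt c t -> lt t e -> P t.

Section OneOrder.
Variable lt : M -> M -> Prop.
Hypothesis T : tame_order lt.

Lemma between2 a b c : lt a b -> lt a c -> exists d, [/\ lt a d, lt d b & lt d c].
Proof.
move=> ab ac; have [bc|[e|cb]] := to_total T b c.
- by have [d [ad db]] := to_dense T ab; exists d; split=> //; ord T.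
- by have [d [ad db]] := to_dense T ab; exists d; split=> //; rewrite -e.
- by have [d [ad db]] := to_dense T ac; exists d; split=> //; ord T.
Qed.

Lemma near_dicho X a : definable_pred X -> near_r lt X a \/ near_r lt (fun x => ~ X x) a.
Proof.
by move=> /(to_germr T a)[b [ab []]] H; [left|right]; exists b; split.
Qed.

Lemma near_in X a b : lt a b -> near_r lt X a ->
  exists e, [/\ lt a e, lt e b & forall t, lt a t -> lt t e -> X t].
Proof.
move=> ab [e [ae H]]; have [d [? db de]] := between2 ab ae.
by exists d; split=> // t at_ td; apply: H => //; ord T.
Qed.

Lemma near_ex X a b : lt a b -> near_r lt X a -> exists t, [/\ lt a t, lt t b & X t].
Proof.
move=> ab /(near_in ab)[e [ae eb H]]; have [d [? ?]] := to_dense T ae.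
by exists d; split=> //; [ord T|apply: H].
Qed.

Lemma near_and X Y a : near_r lt X a -> near_r lt Y a ->
  near_r lt (fun t => X t /\ Y t) a.
Proof.
move=> [e [ae H]] [e' [ae' H']]; have [d [? de de']] := between2 ae ae'.
by exists d; split=> // t at_ td; split; [apply: H|apply: H'] => //; ord T.
Qed.

Lemma near_mono X Y a : (forall t, lt a t -> X t -> Y t) -> near_r lt X a -> near_r lt Y a.
Proof. by move=> XY [e [ae H]]; exists e; split=> // t *; apply: XY => //; apply: H. Qed.

Definition is_inf (P : M -> Prop) (m : M) : Prop :=
  (forall y, P y -> ~ lt y m) /\ forall c, (forall y, P y -> ~ lt y c) -> ~ lt m c.

Lemma inf_lt P m e : is_inf P m -> lt m e -> exists2 y, P y & lt y e.
Proof.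
move=> [_ mP] me; apply: contrapT => H; apply: mP me => y Py ye.
by apply: H; exists y.
Qed.

(** A definable choice of infima: the default [d], used where the fibre is empty or unbounded below,
    makes [p] total, and uniqueness of infima makes its graph definable. *)
Lemma inf_fun (P : M -> M -> Prop) (d : M) : definable_rel P -> exists2 p, definable_fun S p &
  forall t, (exists y, P t y) -> (exists c, forall y, P t y -> ~ lt y c) ->
  is_inf (P t) (p t).
Proof.
have dl := to_def T => dP.
pose good t := (exists y, P t y) /\ (exists c, forall y, P t y -> ~ lt y c).
pose R t m := (good t /\ is_inf (P t) m) \/ (~ good t /\ m = d).
have dR : definable_rel R by rewrite /R /good /is_inf; dfn.
have /choice[p pP] t : exists m, R t m.
  have [gt|gt] := pselect (good t); last by exists d; right.
  have [exP [c cP]] := gt.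
  have [|m [m1 m2]] := to_inf T (X := P t) _ exP cP; first by dfn.
  by exists m; left.
exists p.
  apply: (graph_definable_fun dR) => t m; split=> [Rm|->//].
  case: (pP t) Rm => [][gt]; last by move=> ->; case; case.
  move=> [p1 p2] [] [] // _ [m1 m2].
  have := p2 _ m1; have := m2 _ p1; move=> ? ?.
  by have [|[|]] := to_total T m (p t).
by move=> t e1 e2; have [[]//|[[]]] := pP t; split.
Qed.
End OneOrder.

Section TwoOrders.
Variables lt1 lt2 : M -> M -> Prop.
Hypotheses (T1 : tame_order lt1) (T2 : tame_order lt2).
Variable f : M -> M.
Hypothesis df : definable_fun S f.

Let dl1 : definable_rel lt1 := to_def T1.
Let dl2 : definable_rel lt2 := to_def T2.
Let T1' := tame_rev T1.

(** Let [m] be the infimum of the points t of ]x, y] at which f(t) > f(x) fails. The germ at [x]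
    gives m > x, the left germ at [m] gives f(m) > f(x), and the right germ at [m] then excludes
    failures just after [m]. *)
Lemma increasing_of_local a b :
  (forall c, lt1 a c -> lt1 c b -> near_r lt1 (fun t => lt2 (f c) (f t)) c /\
     near_r (rev_lt lt1) (fun t => lt2 (f t) (f c)) c) ->
  forall x y, lt1 a x -> lt1 y b -> lt1 x y -> lt2 (f x) (f y).
Proof.
move=> H x y ax yb xy; apply: contrapT => nxy.
pose B t := [/\ lt1 x t, ~ lt1 y t & ~ lt2 (f x) (f t)].
have dB : definable_pred B.
  suff : definable_pred (fun t => lt1 x t /\ ~ lt1 y t /\ ~ lt2 (f x) (f t)).
    move=> d g dg; apply: edefinable_iff (d g dg) => e.
    by split=> [[? []]|[]].
  by dfn.
have By : B y by split=> //; apply: (to_irr T1).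
have [|m [m1 m2]] := to_inf T1 (c := x) dB (ex_intro _ y By).
  by move=> z [xz _ _]; ord T1.
have my : ~ lt1 y m := m1 y By.
have xm : ~ lt1 m x by apply: m2 => z [xz _ _]; ord T1.
have xb : lt1 x b by ord T1.
have [[e [xe He]] _] := H x ax xb.
have {}xm : lt1 x m.
  have [//|[xm'|//]] := to_total T1 x m.
  case: (m2 e); last by rewrite -xm'.
  by move=> z [xz _ nz] ze; apply: nz; apply: He.
have am : lt1 a m by ord T1.
have mb : lt1 m b by ord T1.
have below t : lt1 x t -> lt1 t m -> lt2 (f x) (f t).
  move=> xt tm; apply: contrapT => nt; apply: (m1 t) => //; split=> //; ord T1.
have [nr nl] := H m am mb.
have [t [mt tx ftm]] := near_ex T1' xm nl.
have fxm : lt2 (f x) (f m) by apply: (to_trans T2 _ ftm); apply: below.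
have [e' [me' He']] := nr.
case: (m2 e') => // z [xz zy nz] ze'; apply: nz.
have [zm|[->//|mz]] := to_total T1 z m; first exact: below.
by apply: (to_trans T2 fxm _); apply: He'.
Qed.

(** A downward crossing of the level [v]; with [lt1] reversed the same formula describes an upward
    crossing. *)
Definition drop_at (z : M) : Prop :=
  exists v, near_r (rev_lt lt1) (fun y => lt2 v (f y)) z /\
            near_r lt1 (fun y => ~ lt2 v (f y)) z.

(* A function with a strict local minimum at every point drops at points
   arbitrarily near each end of the interval; since the hypothesis is symmetric,
   reversing lt1 makes it also rise at such points, a contradiction. *)
Lemma near_drop_at a b : lt1 a b ->
  (forall c, lt1 a c -> lt1 c b -> near_r lt1 (fun t => lt2 (f c) (f t)) c /\
     near_r (rev_lt lt1) (fun t => lt2 (f c) (f t)) c) ->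
  near_r (rev_lt lt1) drop_at b.
Proof.
move=> ab H.
pose B x := forall y, lt1 x y -> lt1 y b -> lt2 (f x) (f y).
have dB : definable_pred B by rewrite /B; dfn.
have dP : definable_pred drop_at by rewrite /drop_at /near_r /rev_lt; dfn.
(* If [B] held on a left neighbourhood of [b], then [f] would be increasing there, against the
   strict local minima seen from the left. *)
have [nB|nB] := near_dicho T1' b dB.
  have [e [be ea HB]] := near_in T1' ab nB.
  have [y [ey yb]] := to_dense T1 be.
  have [|_ nl] := H y _ yb; first by move: ea; rewrite /rev_lt => ?; ord T1.
  have [x [yx xe fyx]] := near_ex T1' ey nl.
  have Bx := HB x; rewrite /rev_lt in yx xe Bx be ea.
  have fxy : lt2 (f x) (f y) by apply: Bx => //; ord T1.
  by ord T2.
have [//|nP] := near_dicho T1' b dP; exfalso.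
(* The point [c] violates [B], and beyond it there is neither a drop nor a point of [B]; one of the
   two is now produced. *)
have [c [bc ca [nBc nPc]]] : exists c, [/\ lt1 c b, lt1 a c & ~ B c /\
    forall d, lt1 c d -> lt1 d b -> ~ drop_at d /\ ~ B d].
  have [e [be ea He]] := near_in T1' ab (near_and T1' nB nP).
  rewrite /rev_lt in be ea He.
  have [c [ec cb]] := to_dense T1 be.
  exists c; split=> //; first by ord T1.
  split; first by case: (He c).
  by move=> d cd db; have [] := He d db (to_trans T1 ec cd).
have [nr _] := H c ca bc.
have dG : definable_pred (fun y => lt2 (f c) (f y)) by dfn.
have [near1|near2] := near_dicho T1' b dG.
  have [e [be ec He]] := near_in T1' bc near1; rewrite /rev_lt in be ec He.
  (* The last point [d] of ]c, b[ with value at most f(c) satisfies [B]. *)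
  pose D y := lt1 c y /\ lt1 y b /\ ~ lt2 (f c) (f y).
  have dD : definable_pred D by rewrite /D; dfn.
  have [y0 Dy0] : exists y, D y.
    apply: contrapT => nD; apply: nBc => y cy yb; apply: contrapT => ny.
    by apply: nD; exists y.
  have De y : D y -> ~ lt1 e y by move=> [_ [yb ny]] ey; apply/ny/He.
  have [d [d1 d2]] := to_sup T1 dD (ex_intro _ y0 Dy0) De.
  have y0d := d1 _ Dy0; have de := d2 _ De; have [cy0 [y0b _]] := Dy0.
  have cd : lt1 c d by ord T1.
  have db : lt1 d b by ord T1.
  have ad : lt1 a d by ord T1.
  have ncd : ~ lt2 (f c) (f d).
    move=> fcd; have [_ [g [dg Hg]]] := H d ad db; rewrite /rev_lt in dg Hg.
    case: (d2 g) => // y Dy gy; have [cy [yb ny]] := Dy; apply: ny.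
    have [yd|[->//|dy]] := to_total T1 y d; last by have := d1 y Dy.
    exact: (to_trans T2 fcd (Hg _ yd gy)).
  have [_ []] := nPc d cd db; move=> y dy yb.
  have fcy : lt2 (f c) (f y).
    apply: contrapT => ny; apply: (d1 y) => //; split=> //; ord T1.
  by ord T2.
have [e [be ec He]] := near_in T1' bc near2; rewrite /rev_lt in be ec He.
(* Past the supremum [d] of the points with value above f(c), values stay at most f(c). Since [d] is
   a local minimum, f(d) is at most f(c) too, and [f] drops at [d] through this level. *)
pose G y := lt1 c y /\ lt1 y b /\ lt2 (f c) (f y).
have dGG : definable_pred G by rewrite /G; dfn.
have [y0 Gy0] : exists y, G y.
  by have [y [? ? ?]] := near_ex T1 bc nr; exists y.
have Ge y : G y -> ~ lt1 e y by move=> [_ [yb ny]] ey; exact: (He y).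
have [d [d1 d2]] := to_sup T1 dGG (ex_intro _ y0 Gy0) Ge.
have y0d := d1 _ Gy0; have de := d2 _ Ge; have [cy0 [y0b _]] := Gy0.
have cd : lt1 c d by ord T1.
have db : lt1 d b by ord T1.
have ad : lt1 a d by ord T1.
have above y : lt1 d y -> lt1 y b -> ~ lt2 (f c) (f y).
  move=> dy yb ny; apply: (d1 y) => //; split=> //; ord T1.
have ncd : ~ lt2 (f c) (f d).
  move=> fcd; have [nr' _] := H d ad db.
  have [y [dy yb fdy]] := near_ex T1 db nr'.
  by apply: (above y) => //; apply: (to_trans T2 fcd fdy).
have [nd _] := nPc d cd db; apply: nd.
exists (f c); split; last by exists b.
have [//|[g [dg Hg]]] := near_dicho T1' d dG; rewrite /rev_lt in dg Hg.
case: (d2 g) => // y Gy gy; have [cy [yb fy]] := Gy.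
have [yd|[yd|dy]] := to_total T1 y d; last by have := d1 y Gy.
  exact: (Hg y).
by apply: ncd; rewrite -yd.
Qed.
End TwoOrders.

Lemma no_local_min lt1 lt2 f a b : tame_order lt1 -> tame_order lt2 ->
  definable_fun S f -> lt1 a b ->
  ~ (forall c, lt1 a c -> lt1 c b -> near_r lt1 (fun t => lt2 (f c) (f t)) c /\
     near_r (rev_lt lt1) (fun t => lt2 (f c) (f t)) c).
Proof.
move=> T1 T2 df ab H; have T1' := tame_rev T1.
have [e [be ea He]] := near_in T1' ab (near_drop_at T1 T2 df ab H).
have H' c : rev_lt lt1 b c -> rev_lt lt1 c e ->
    near_r (rev_lt lt1) (fun t => lt2 (f c) (f t)) c /\
    near_r (rev_lt (rev_lt lt1)) (fun t => lt2 (f c) (f t)) c.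
  rewrite /rev_lt in ea be *.
  by move=> cb ec; have ac : lt1 a c by [ord T1]; have [? ?] := H c ac cb.
have nd : near_r lt1 (drop_at (rev_lt lt1) lt2 f) e := near_drop_at T1' T2 df be H'.
(* At [t] the function rises through [v] and drops through [w]: its values to the right give v < w,
   those to the left w < v. *)
have [t [et tb [v [v1 v2]]]] := near_ex T1 be nd.
have [w [w1 w2]] := He t tb et.
have [x xt] := to_below T1 t; have [y ty] := to_above T1 t.
have [t1 [_ _ [vt1 wt1]]] := near_ex T1 ty (near_and T1 v1 w2).
have [t2 [_ _ [vt2 wt2]]] := near_ex T1' xt (near_and T1' v2 w1).
have vw : lt2 v w by ord T2.
by ord T2.
Qed.

(** Otherwise [f] jumps up to the right of every point. Left germs at points near [a] leave three
    cases: smaller values make [f] increasing with gaps in its range, larger values contradict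
    [no_local_min], and equal values contradict the jumps. *)
Lemma exists_right_usc lt1 lt2 f a b : tame_order lt1 -> tame_order lt2 ->
  definable_fun S f -> lt1 a b ->
  exists t, [/\ lt1 a t, lt1 t b &
    forall y, lt2 (f t) y -> near_r lt1 (fun s => lt2 (f s) y) t].
Proof.
move=> T1 T2 df ab; apply: contrapT => nex.
have T1' := tame_rev T1; have dl1 := to_def T1; have dl2 := to_def T2.
have jump t : lt1 a t -> lt1 t b ->
    exists y, lt2 (f t) y /\ near_r lt1 (fun s => ~ lt2 (f s) y) t.
  move=> at_ tb; apply: contrapT => H; apply: nex; exists t; split=> // y fty.
  have [//|nn] := @near_dicho _ T1 (fun s => lt2 (f s) y) t ltac:(dfn).
  by case: H; exists y.
have up t : lt1 a t -> lt1 t b -> near_r lt1 (fun s => lt2 (f t) (f s)) t.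
  move=> at_ tb; have [y [fty]] := jump t at_ tb.
  by apply: near_mono => // s _ ?; ord T2.
have [inc|ninc] := @near_dicho _ T1
  (fun c => near_r (rev_lt lt1) (fun t => lt2 (f t) (f c)) c) a
  ltac:(rewrite /near_r /rev_lt; dfn).
  have [e [ae eb He]] := near_in T1 ab inc.
  have mono : forall x y, lt1 a x -> lt1 y e -> lt1 x y -> lt2 (f x) (f y).
    apply: (increasing_of_local T1 T2 df) => c ac ce; split; last exact: He.
    by apply: up => //; ord T1.
  have jump' s : lt1 a s -> lt1 s e -> exists y, lt2 (f s) y /\
      forall s', lt1 s s' -> lt1 s' e -> ~ lt2 (f s') y.
    move=> as_ se; have sb : lt1 s b by ord T1.
    have [y [fsy ny]] := jump s as_ sb; exists y; split=> // s' ss' s'e.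
    have [s'' [ss'' s''s' ns'']] := near_ex T1 ss' ny.
    have := mono s'' s' (to_trans T1 as_ ss'') s'e s''s'.
    by move=> ? ?; ord T2.
  have [t0 [at0 t0e]] := to_dense T1 ae.
  have [y [ft0y Hy]] := jump' t0 at0 t0e.
  (* The infimum [m] of the values beyond [t0] is compared with the range [A]: if [A] filled an
     interval just above [m], there would be no room for jumps; if it missed one, [m] could not be
     the infimum of values of which none is least. *)
  pose G z := exists t, [/\ lt1 t0 t, lt1 t e & z = f t].
  have dG : definable_pred G.
    suff : definable_pred (fun z => exists t, lt1 t0 t /\ lt1 t e /\ z = f t).
      move=> d g dg; apply: edefinable_iff (d g dg) => en.
      by split=> -[t]; [move=> [? [? ?]]|move=> []]; exists t.
    by dfn.
  have [t1 [t0t1 t1e]] := to_dense T1 t0e.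
  have exG : exists z, G z by exists (f t1), t1.
  have Gy z : G z -> ~ lt2 z y by move=> [t [tt te ->]]; exact: Hy.
  have [m Hm] := to_inf T2 dG exG Gy.
  pose A z := exists t, lt1 a t /\ lt1 t e /\ z = f t.
  have [nA|nA] := @near_dicho _ T2 A m ltac:(rewrite /A; dfn).
    have [u mu] := to_above T2 m.
    have [d [md du Hd]] := near_in T2 mu nA.
    have [z [mz zd]] := to_dense T2 md.
    have [s [as_ [se ez]]] := Hd z mz zd.
    have [y' [fsy' Hy']] := jump' s as_ se; rewrite -ez in fsy'.
    have [z' [zz' z'y' z'd]] := between2 T2 fsy' zd.
    have [s' [as' [s'e ez']]] := Hd z' (to_trans T2 mz zz') z'd.
    have ss' : lt1 s s'.
      have [//|[es|s's]] := to_total T1 s s'.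
        by rewrite ez ez' es in zz'; case: (to_irr T2 zz').
      by have := mono s' s as' se s's; rewrite -ez -ez' => ?; ord T2.
    by apply: (Hy' s' ss' s'e); rewrite -ez'.
  have [d [md Hd]] := nA.
  have [_ [t [t0t te ->]] ftd] := inf_lt Hm md.
  have [t' [t0t' t't]] := to_dense T1 t0t.
  have m1 : ~ lt2 (f t') m by apply: Hm.1; exists t'; split=> //; ord T1.
  have at' : lt1 a t' by ord T1.
  have ft't := mono t' t at' te t't.
  by apply: (Hd (f t)) => //; [ord T2|exists t; split=> //; ord T1].
have [e [ae eb He]] := near_in T1 ab ninc.
have [mn|nmn] := @near_dicho _ T1
  (fun c => near_r (rev_lt lt1) (fun t => lt2 (f c) (f t)) c) a
  ltac:(rewrite /near_r /rev_lt; dfn).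
  have [d [ad de Hd]] := near_in T1 ae mn.
  apply: (no_local_min T1 T2 df ad) => c ac cd; split; last exact: Hd.
  by apply: up => //; ord T1.
have [d [ad de Hd]] := near_in T1 ae nmn.
have [c [ac cd]] := to_dense T1 ad.
have ce : lt1 c e by ord T1.
have [/(He c ac ce)//|n1] := @near_dicho _ T1' (fun t => lt2 (f t) (f c)) c ltac:(dfn).
have [/(Hd c ac cd)//|n2] := @near_dicho _ T1' (fun t => lt2 (f c) (f t)) c ltac:(dfn).
have [g [gc ga Hg]] := near_in T1' ac (near_and T1' n1 n2); rewrite /rev_lt in gc ga Hg.
have eqc t : lt1 g t -> lt1 t c -> f t = f c.
  by move=> gt tc; have [? ?] := Hg t tc gt; have [|[|]] := to_total T2 (f t) (f c).
have [t [gt tc]] := to_dense T1 gc.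
have at_ : lt1 a t by ord T1.
have tb : lt1 t b by ord T1.
have [s [ts sc fts]] := near_ex T1 tc (up t at_ tb).
rewrite (eqc t gt tc) (eqc s (to_trans T1 gt ts) sc) in fts.
exact: (to_irr T2 fts).
Qed.

(* The fibre W_t contains the interval ]p(t), q(t)[ where p is an infimum and
   q a supremum (or +oo); p is right upper and q right lower semicontinuous at
   some point, to the right of which an interval below q and above p works. *)
Lemma uniform_interval_above lt1 lt2 W c a b :
  tame_order lt1 -> tame_order lt2 -> definable_rel W -> lt1 a b ->
  (forall t, lt1 a t -> lt1 t b -> exists y z, lt2 c y /\ lt2 y z /\
     forall w, lt2 y w -> lt2 w z -> W t w) ->
  exists a' b' y z, [/\ lt1 a' b', lt2 y z & forall t, lt1 a' t -> lt1 t b' ->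
    [/\ lt1 a t, lt1 t b & forall w, lt2 y w -> lt2 w z -> W t w]].
Proof.
move=> T1 T2 dW ab HW; have T2' := tame_rev T2.
have dl1 := to_def T1; have dl2 := to_def T2.
pose P t y := lt2 c y /\ exists z, lt2 y z /\ forall w, lt2 y w -> lt2 w z -> W t w.
have dP : definable_rel P by rewrite /P; dfn.
have [p dp pP] := inf_fun T2 c dP.
have {}pP t : lt1 a t -> lt1 t b -> is_inf lt2 (P t) (p t).
  move=> at_ tb; apply: pP.
    by have [y [z [cy [yz H]]]] := HW t at_ tb; exists y; split=> //; exists z.
  by exists c => y [cy _]; ord T2.
have pW t : lt1 a t -> lt1 t b -> near_r lt2 (W t) (p t).
  move=> at_ tb; have [//|[e [pe He]]] := @near_dicho _ T2 (W t) (p t) ltac:(dfn).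
  have [y [cy [z [yz Hz]]] ye] := inf_lt (pP t at_ tb) pe.
  have py : ~ lt2 y (p t).
    by apply: (pP t at_ tb).1; split=> //; exists z.
  have [w [yw wz we]] := between2 T2 yz ye.
  by case: (He w) => //; [ord T2|apply: Hz].
pose Q t e := lt2 (p t) e /\ forall w, lt2 (p t) w -> lt2 w e -> W t w.
have dQ : definable_rel Q by rewrite /Q; dfn.
have [q dq qQ] := inf_fun T2' c dQ.
(* The case q = +oo, where the upper endpoint may be taken anywhere above [p]. *)
pose full t := forall w, lt2 (p t) w -> W t w.
have [fl|nfl] := @near_dicho _ T1 full a ltac:(rewrite /full; dfn).
  have [e [ae eb He]] := near_in T1 ab fl.
  have [t [at_ te usc]] := exists_right_usc T1 T2 dp ae.
  have [y py] := to_above T2 (p t); have [z yz] := to_above T2 y.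
  have [d [td de Hd]] := near_in T1 te (usc y py).
  exists t, d, y, z; split=> // s ts sd; split; [ord T1|ord T1|move=> w yw wz].
  by apply: He; [ord T1|ord T1|have := Hd s ts sd => ?; ord T2].
have [e [ae eb He]] := near_in T1 ab nfl.
have {}qQ t : lt1 a t -> lt1 t e ->
    lt2 (p t) (q t) /\ forall w, lt2 (p t) w -> lt2 w (q t) -> W t w.
  move=> at_ te; have tb : lt1 t b by ord T1.
  have [d [pd Hd]] := pW t at_ tb.
  have [w [pw nw]] : exists w, lt2 (p t) w /\ ~ W t w.
    apply: contrapT => H; apply: (He t at_ te) => w pw.
    by apply: contrapT => nw; apply: H; exists w.
  have Qw x : Q t x -> ~ rev_lt lt2 x w by move=> [px Hx] wx; apply/nw/Hx.
  have Qd : Q t d by split.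
  have qinf := qQ t (ex_intro _ d Qd) (ex_intro _ w Qw).
  split; first by have := qinf.1 d Qd; rewrite /rev_lt => ?; ord T2.
  by move=> x px xq; have [y [py Hy] xy] := inf_lt qinf xq; apply: Hy.
(* Both semicontinuities must hold at a common point. Since [p] has its own somewhere in every
   subinterval, the germ dichotomy gives it on a whole interval, in which a point for [q] is then
   found. *)
have [d [ad de Hd]] : exists d, [/\ lt1 a d, lt1 d e & forall t, lt1 a t -> lt1 t d ->
    forall y, lt2 (p t) y -> near_r lt1 (fun s => lt2 (p s) y) t].
  have [us|nus] := @near_dicho _ T1 (fun t =>
    forall y, lt2 (p t) y -> near_r lt1 (fun s => lt2 (p s) y) t) a
    ltac:(rewrite /near_r; dfn).
    exact: (near_in T1 ae us).
  have [d [ad de Hd]] := near_in T1 ae nus.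
  have [t [at_ td usc]] := exists_right_usc T1 T2 dp ad.
  by case: (Hd t at_ td).
have [t [at_ td lsc]] := exists_right_usc T1 T2' dq ad.
have te : lt1 t e by ord T1.
have [pq _] := qQ t at_ te.
have [z [pz zq]] := to_dense T2 pq; have [y [py yz]] := to_dense T2 pz.
have [g [tg gd Hg]] := near_in T1 td (near_and T1 (Hd t at_ td y py) (lsc z zq)).
exists t, g, y, z; split=> // s ts sg; split; [ord T1|ord T1|move=> w yw wz].
have [psy zqs] := Hg s ts sg; rewrite /rev_lt in zqs.
by apply: (qQ s _ _).2; [ord T1|ord T1|ord T2|ord T2].
Qed.

(** The point [a] also serves as the bound [c] of the previous lemma. For t near [a], either all
    fibres contain an interval above [a], or none does and all contain one below [a]; the latter is
    the former with the order of the values reversed. *)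
Lemma uniform_interval1 lt W a b : tame_order lt -> definable_rel W -> lt a b ->
  (forall t, lt a t -> lt t b -> exists y z, lt y z /\
     forall w, lt y w -> lt w z -> W t w) ->
  exists a' b' y z, [/\ lt a' b', lt y z & forall t, lt a' t -> lt t b' ->
    [/\ lt a t, lt t b & forall w, lt y w -> lt w z -> W t w]].
Proof.
move=> T dW ab HW; have T' := tame_rev T; have dl := to_def T.
have [n1|n2] := @near_dicho _ T (fun t => exists y z, lt a y /\ lt y z /\
     forall w, lt y w -> lt w z -> W t w) a ltac:(dfn).
  have [e [ae eb He]] := near_in T ab n1.
  have [a' [b' [y [z [? ? H]]]]] := uniform_interval_above T T dW ae He.
  exists a', b', y, z; split=> // t a't tb'; have [? ? ?] := H t a't tb'.
  by split=> //; ord T.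
have [e [ae eb He]] := near_in T ab n2.
have [|a' [b' [y [z [? zy H]]]]] :=
    @uniform_interval_above lt (rev_lt lt) W a a e T T' dW ae.
  move=> t at_ te; have tb : lt t b by ord T.
  have [y [z [yz Hyz]]] := HW t at_ tb; rewrite /rev_lt.
  have za : ~ lt a z.
    move=> az; have [x [xz xa xy]] := between2 T' az yz; rewrite /rev_lt in xz xa xy.
    apply: (He t at_ te); exists x, z; do 2!split=> //.
    by move=> w xw wz; apply: Hyz => //; ord T.
  have [x [yx xz]] := to_dense T yz.
  exists x, y; split; [ord T|split=> // w wx yw].
  by apply: Hyz => //; ord T.
exists a', b', z, y; split=> // t a't tb'; have [? ? Hw] := H t a't tb'.
by split=> [//||w zw wy]; [ord T|apply: Hw].
Qed.

End OneVariable.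

(** * One-sided germs of finite unions of convex sets *)

Section Germs.
Context (M : Type) (lt : M -> M -> Prop).
Hypotheses (lt_tr : forall y x z, lt x y -> lt y z -> lt x z)
  (lt_tot : forall x y, lt x y \/ x = y \/ lt y x)
  (lt_above : forall x, exists y, lt x y).

Definition convex (X : set M) : Prop :=
  forall x y z, X x -> X y -> lt x z -> lt z y -> X z.

Definition decided_right (X : set M) (a : M) : Prop := exists b, lt a b /\
    ((forall x, lt a x -> lt x b -> X x) \/ (forall x, lt a x -> lt x b -> ~ X x)).

(** If the set meets every right neighbourhood of [a], convexity makes it contain ]a, y[ for any of
    its points y > a. *)
Lemma decided_right_convex X a : convex X -> decided_right X a.
Proof.
move=> cX; have [[b [ab Hb]]|H] :=
    pselect (exists b, lt a b /\ forall x, lt a x -> lt x b -> ~ X x).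
  by exists b; split=> //; right.
have Hx b : lt a b -> exists x, [/\ lt a x, lt x b & X x].
  move=> ab; apply: contrapT => n; apply: H; exists b; split=> // x ax xb Xx.
  by apply: n; exists x.
have [b ab] := lt_above a; have [y [ay _ Xy]] := Hx b ab.
exists y; split=> //; left=> z az zy; have [x [ax xz Xx]] := Hx z az.
exact: cX Xx Xy xz zy.
Qed.

Lemma decided_rightU X Y a : decided_right X a -> decided_right Y a ->
  decided_right (X `|` Y) a.
Proof.
move=> [b [ab Hb]] [c [ac Hc]].
suff [d [ad db dc]] : exists d, [/\ lt a d, forall x, lt x d -> lt x b
    & forall x, lt x d -> lt x c].
  exists d; split=> //.
  case: Hb => Hb; first by left=> x ax /db xb; left; apply: Hb.
  case: Hc => Hc; first by left=> x ax /dc xc; right; apply: Hc.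
  by right=> x ax xd [|]; [apply: Hb|apply: Hc] => //; [apply: db|apply: dc].
have [bc|[<-|cb]] := lt_tot b c; [exists b|exists b|exists c]; split=> // x xb.
  exact: lt_tr xb bc.
exact: lt_tr xb cb.
Qed.

Lemma decided_right_fin k (F : 'I_k -> set M) X I a :
  (forall i, convex (F i)) -> X `&` I = \bigcup_i F i ->
  (exists b, lt a b /\ forall x, lt a x -> lt x b -> I x) -> decided_right X a.
Proof.
move=> cF XI [b [ab bI]].
have H (s : seq 'I_k) : decided_right [set x | exists2 i, i \in s & F i x] a.
  elim: s => [|i s IH].
    by exists b; split=> //; right=> x _ _ [].
  have := decided_rightU (decided_right_convex a (cF i)) IH.
  congr decided_right; apply/seteqP; split=> x /=.
    by case=> [Fx|[j js Fx]]; [exists i|exists j] => //; rewrite inE ?eqxx// js orbT.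
  move=> [j]; rewrite inE => /orP[/eqP->|js] Fx; [by left|right; by exists j].
have [c [ac Hc]] := H (enum 'I_k).
have XF x : I x -> X x <-> exists2 i, i \in enum 'I_k & F i x.
  move=> Ix; split=> [Xx|[i _ Fx]].
    have : (X `&` I) x by []. 
    by rewrite XI => -[i _ Fx]; exists i => //; rewrite mem_enum.
  have : (\bigcup_i F i) x by exists i.
  by rewrite -XI => -[].
suff [d [ad db dc]] : exists d, [/\ lt a d, forall x, lt x d -> lt x b
    & forall x, lt x d -> lt x c].
  exists d; split=> //; case: Hc => Hc; [left|right] => x ax xd.
    by apply/XF; [apply: bI => //; apply: db|apply: Hc => //; apply: dc].
  by move=> Xx; apply: (Hc x ax (dc x xd)); apply/XF => //; apply: bI => //; apply: db.
have [bc|[<-|cb]] := lt_tot b c; [exists b|exists b|exists c]; split=> // x xb.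
  exact: lt_tr xb bc.
exact: lt_tr xb cb.
Qed.
End Germs.

(** * Tameness of the order from local o-minimality and definable completeness *)

Section TameLt.
Context (L : language) {disp : Order.disp_t} {M : orderTopologicalType disp}.
Variable S : structure L M.
Hypotheses (hdlo : DLO_without_endpoints M) (hcomplete : definably_complete S)
  (hlocal : locally_o_minimal S).

Let lt (x y : M) : Prop := x < y.

Lemma ep_lt_Fin (x y : M) : ep_lt (Fin x) (Fin y) = (x < y).
Proof. by rewrite /ep_lt /= ltNge. Qed.

Lemma ep_lt_trans (x y : M) p : ep_lt p (Fin x) -> x < y -> ep_lt p (Fin y).
Proof. by case: p => // z; rewrite !ep_lt_Fin => /lt_trans; apply. Qed.

Lemma ep_gt_trans (x y : M) p : ep_lt (Fin x) p -> y < x -> ep_lt (Fin y) p.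
Proof. by case: p => // z; rewrite !ep_lt_Fin => ? /lt_trans; apply. Qed.

Lemma open_interval_convex (I : set M) : open_interval I -> convex lt I.
Proof.
move=> [_ [p [q ->]]] x y z /= [px xq] [py yq] xz zy.
by split; [apply: ep_lt_trans xz|apply: ep_gt_trans zy].
Qed.

Lemma open_interval_right (I : set M) a : open_interval I -> I a ->
  exists b, a < b /\ forall x, a < x -> x < b -> I x.
Proof.
move=> oI Ia; have cI := open_interval_convex oI.
suff [b ab Ib] : exists2 b, a < b & I b.
  by exists b; split=> // x ax xb; apply: cI ax xb.
case: oI Ia => _ [p [q ->]] /= [pa]; case: q => [|q|] //.
  rewrite ep_lt_Fin => /(hdlo.1 a q)[b /andP[ab bq]].
  by exists b => //; rewrite ep_lt_Fin; split=> //; apply: ep_lt_trans ab.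
by have [_ [b ab]] := hdlo.2 a; exists b => //; split=> //; apply: ep_lt_trans ab.
Qed.

Lemma open_interval_left (I : set M) a : open_interval I -> I a ->
  exists b, b < a /\ forall x, x < a -> b < x -> I x.
Proof.
move=> oI Ia; have cI := open_interval_convex oI.
suff [b ab Ib] : exists2 b, b < a & I b.
  by exists b; split=> // x ax xb; apply: cI xb ax.
case: oI Ia => _ [p [q ->]] /= []; case: p => [|p|] //.
  by have [[b ba] _] := hdlo.2 a => _ aq; exists b => //; split=> //; apply: ep_gt_trans ba.
rewrite ep_lt_Fin => /(hdlo.1 p a)[b /andP[pb ba]] aq.
by exists b => //; rewrite ep_lt_Fin; split=> //; apply: ep_gt_trans ba.
Qed.

Lemma tame_lt : tame_order S (fun x y : M => x < y).
Proof.
have tr : forall y x z : M, lt x y -> lt y z -> lt x z.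
  by move=> y x z; apply: lt_trans.
have tot (x y : M) : lt x y \/ x = y \/ lt y x.
  by case: (ltgtP x y) => H; [left|right; right|right; left].
have ab (x : M) : exists y, lt x y := (hdlo.2 x).2.
have be (x : M) : exists y, lt y x := (hdlo.2 x).1.
have germ (X : M -> Prop) a : definable_pred S X -> exists k (F : 'I_k -> set M) I,
    [/\ open_interval I, I a, forall i, convex lt (F i) & X `&` I = \bigcup_i F i].
  move=> dX; have [I [oI Ia [k [F [oF XI]]]]] := hlocal (definable_pred_definable1 dX a) a.
  exists k, F, I; split=> // i; case: (oF i) => [[b ->]|]; last exact: open_interval_convex.
  by move=> x y z /= -> ->; rewrite /lt => bz /(lt_trans bz); rewrite ltxx.
split=> //.
- by move=> x; rewrite ltxx.
- by move=> x y /hdlo.1[z /andP[? ?]]; exists z.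
- by move=> f g df dg; dfn.
- move=> X a /(germ X a)[k [F [I [oI Ia cF XI]]]].
  by apply: decided_right_fin tr tot ab _ _ _ _ _ cF XI _; apply: open_interval_right.
- move=> X a /(germ X a)[k [F [I [oI Ia cF XI]]]].
  (* Left germs are right germs for the reversed relation. *)
  suff [b [ba H]] : decided_right (fun x y => lt y x) X a.
    by exists b; split=> //; case: H => H; [left|right] => x ? ?; apply: H.
  apply: (@decided_right_fin _ (fun x y => lt y x) _ _ be _ F X I a _ XI).
  + by move=> y x z xy yz; apply: tr yz xy.
  + by move=> x y; have [|[|]] := tot x y; tauto.
  + by move=> i x y z Fx Fy xz zy; apply: (cF i y x).
  + exact: open_interval_left.
- move=> X dX [x Xx] c cX.
  have [[s [s1 s2]] _] := hcomplete (definable_pred_definable1 dX x).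
  case: s s1 s2 => [|m|] s1 s2.
  + by have := s1 x Xx.
  + exists m; split=> [y /s1|d dX']; first by rewrite /= leNgt => /negP.
    apply/negP; rewrite -leNgt; apply: (s2 (Fin d)) => y Xy /=.
    by rewrite leNgt; apply/negP/dX'.
  + have // : ep_le (PInf : endpoint M) (Fin c).
    by apply: s2 => y Xy /=; rewrite leNgt; apply/negP/cX.
- move=> X dX [x Xx] c cX.
  have [_ [s [s1 s2]]] := hcomplete (definable_pred_definable1 dX x).
  case: s s1 s2 => [|m|] s1 s2.
  + have // : ep_le (Fin c) (NInf : endpoint M).
    by apply: s2 => y Xy /=; rewrite leNgt; apply/negP/cX.
  + exists m; split=> [y /s1|d dX']; first by rewrite /= leNgt => /negP.
    apply/negP; rewrite -leNgt; apply: (s2 (Fin d)) => y Xy /=.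
    by rewrite leNgt; apply/negP/dX'.
  + by have := s1 x Xx.
Qed.
End TameLt.

(** * Uniform choice over boxes *)

Section Boxes.
Context (L : language) {disp : Order.disp_t} {M : orderTopologicalType disp}.
Variables (S : structure L M) (lt : M -> M -> Prop).
Hypothesis T : tame_order S lt.
Let dl : definable_rel S lt := to_def T.

Definition inbox k (a b u : 'I_k -> M) : Prop :=
  forall i, lt (a i) (u i) /\ lt (u i) (b i).

Definition box_wf k (a b : 'I_k -> M) : Prop := forall i, lt (a i) (b i).

(** Inclusion alone would admit the empty box, so nondegeneracy is carried along. *)
Definition subbox k (a' b' a b : 'I_k -> M) : Prop :=
  box_wf a' b' /\ forall u, inbox a' b' u -> inbox a b u.

Lemma subbox_trans k (a1 b1 a2 b2 a3 b3 : 'I_k -> M) :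
  subbox a1 b1 a2 b2 -> subbox a2 b2 a3 b3 -> subbox a1 b1 a3 b3.
Proof. by move=> [w1 s1] [w2 s2]; split=> // u /s1/s2. Qed.

Lemma box_point k (a b : 'I_k -> M) : box_wf a b -> exists u, inbox a b u.
Proof. by move=> w; have /choice[u uP] i := to_dense T (w i); exists u. Qed.

Lemma inbox_cons k (a b : 'I_k -> M) x y t u :
  inbox (env_cons x a) (env_cons y b) (env_cons t u) <->
  lt x t /\ lt t y /\ inbox a b u.
Proof.
split=> [H|[xt [ty H]] i].
  have := H ord0; rewrite !env_cons0 => -[? ?]; split=> //; split=> // i.
  by have := H (lift ord0 i); rewrite !env_cons_lift => -[].
by case: (unliftP ord0 i) => [j ->|->]; rewrite ?env_cons0 // !env_cons_lift.
Qed.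

Lemma box_wf_cons k (a b : 'I_k -> M) x y :
  lt x y -> box_wf a b -> box_wf (env_cons x a) (env_cons y b).
Proof.
move=> xy w i; case: (unliftP ord0 i) => [j ->|->]; rewrite ?env_cons0 //.
by rewrite !env_cons_lift.
Qed.

Lemma env_consE k (u : 'I_k.+1 -> M) :
  u = env_cons (u ord0) (fun i => u (lift ord0 i)).
Proof.
apply: funext => i; case: (unliftP ord0 i) => [j ->|->].
  by rewrite env_cons_lift.
by rewrite env_cons0.
Qed.

(** Named so that [uniformize_endpoints] can be applied inside the induction that proves it. *)
Definition uniformizes k : Prop := forall (R : ('I_k -> M) -> M -> Prop) a b,
  definable_family S R -> box_wf a b ->
  (forall u, inbox a b u -> exists y z, lt y z /\
     forall w, lt y w -> lt w z -> R u w) ->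
  exists a' b' y z, [/\ subbox a' b' a b, lt y z &
    forall u w, inbox a' b' u -> lt y w -> lt w z -> R u w].

(** Admissible intervals may be shrunk, so the admissible left endpoints contain an interval and one
    of them can be made independent of [u]; the right endpoint is treated next in the same way. *)
Lemma uniformize_endpoints k (R : ('I_k -> M) -> M -> M -> Prop) a b :
  uniformizes k -> definable_family2 S R ->
  (forall u x y x' y', R u x y -> ~ lt x' x -> ~ lt y y' -> lt x' y' -> R u x' y') ->
  box_wf a b -> (forall u, inbox a b u -> exists x y, lt x y /\ R u x y) ->
  exists a' b' x y, [/\ subbox a' b' a b, lt x y &
    forall u, inbox a' b' u -> R u x y].
Proof.
move=> unif dR mR wab HR.
pose R1 u x := exists y, lt x y /\ R u x y.
have [|u /HR[x [y [xy Rxy]]]|a1 [b1 [x0 [x1 [s1 x01 H1]]]]] := unif R1 a b _ wab.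
- by rewrite /R1; dfn.
- exists x, y; split=> // w xw wy; exists y; split=> //.
  by apply: mR Rxy _ _ _ => //; ord T.
have [x [x0x xx1]] := to_dense T x01.
pose R2 u y := lt x y /\ R u x y.
have [|u iu|a2 [b2 [y0 [y1 [s2 y01 H2]]]]] := unif R2 a1 b1 _ s1.1.
- by rewrite /R2; dfn.
- have [y [xy Rxy]] := H1 u x iu x0x xx1.
  exists x, y; split=> // w xw wy; split=> //.
  by apply: mR Rxy _ _ _ => //; ord T.
have [y [y0y yy1]] := to_dense T y01.
have [u0 iu0] := box_point s2.1.
exists a2, b2, x, y; split; first exact: subbox_trans s2 s1.
  by have [] := H2 u0 y iu0 y0y yy1.
by move=> u iu; have [] := H2 u y iu y0y yy1.
Qed.

Lemma uniformize k : uniformizes k.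
Proof.
elim: k => [|k IH] R a b dR wab HR.
  have E (u v : 'I_0 -> M) : u = v by apply: funext => -[].
  have [|y [z [yz H]]] := HR a; first by case.
  by exists a, b, y, z; split=> // u w _; rewrite (E u a); apply: H.
pose ta i := a (lift ord0 i); pose tb i := b (lift ord0 i).
have wt : box_wf ta tb by move=> i; apply: wab.
have ab0 : lt (a ord0) (b ord0) by apply: wab.
(* For fixed [v] the one-variable case gives a rectangle on which [R] holds. Its sides are then made
   independent of [v], the one in [t] before the one in [w]. *)
pose G v x x' y y' := lt y y' /\ forall t, lt x t -> lt t x' ->
  lt (a ord0) t /\ lt t (b ord0) /\
  forall w, lt y w -> lt w y' -> R (env_cons t v) w.
have GP v : inbox ta tb v -> exists x x', lt x x' /\ exists y y', G v x x' y y'.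
  move=> iv; have [||x [x' [y [y' [xx' yy' H]]]]] :=
    @uniform_interval1 _ _ _ S lt (fun t w => R (env_cons t v) w) _ _ T _ ab0.
  - by dfn.
  - move=> t at_ tb'; apply: HR; rewrite (env_consE a) (env_consE b).
    by apply/inbox_cons.
  exists x, x'; split=> //; exists y, y'; split=> // t xt tx'.
  by have [] := H t xt tx'.
have [||a1 [b1 [x [x' [s1 xx' H1]]]]] := @uniformize_endpoints k
  (fun v x x' => exists y y', G v x x' y y') ta tb IH _ _ wt GP.
- by rewrite /G; dfn.
- move=> v x x' z z' [y [y' [yy' H]]] xz zx' zz'; exists y, y'; split=> //.
  by move=> t zt tz; apply: H; ord T.
have {}H1 u : inbox a1 b1 u -> exists y y', lt y y' /\ G u x x' y y'.
  by move=> /H1[y [y' Gy]]; exists y, y'; split=> //; case: Gy.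
have [||a2 [b2 [y [y' [s2 yy' H2]]]]] := @uniformize_endpoints k
  (fun v y y' => G v x x' y y') a1 b1 IH _ _ s1.1 H1.
- by rewrite /G; dfn.
- move=> v y y' z z' [yy' H] yz zy' zz'; split=> // t xt tx'.
  have [? [? Hw]] := H t xt tx'; do 2!split=> //.
  by move=> w zw wz'; apply: Hw; ord T.
exists (env_cons x a2), (env_cons x' b2), y, y'; split=> //; first split.
- exact: box_wf_cons s2.1.
- move=> u; rewrite (env_consE u) => /inbox_cons[xu [ux iu]].
  rewrite (env_consE a) (env_consE b); apply/inbox_cons.
  have [? [? _]] := (H2 _ iu).2 _ xu ux; do 2!split=> //.
  exact/s1.2/s2.2.
- move=> u w; rewrite (env_consE u) => /inbox_cons[xu [ux iu]] yw wy.
  by have [_ [_ H]] := (H2 _ iu).2 _ xu ux; apply: H.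
Qed.

(** By induction, the germ of the fibre of X to the right of [a ord0] is of the same kind for all
    [v] in a smaller box, and [uniformize] gives these germs a common width. *)
Lemma box_dichotomy k (X : ('I_k -> M) -> Prop) a b : definable_vpred S X -> box_wf a b ->
  exists a' b', subbox a' b' a b /\
    ((forall u, inbox a' b' u -> X u) \/ (forall u, inbox a' b' u -> ~ X u)).
Proof.
elim: k X a b => [|k IH] X a b dX wab.
  have E (u v : 'I_0 -> M) : u = v by apply: funext => -[].
  exists a, b; split=> //.
  by case: (pselect (X a)) => Xa; [left|right] => u _; rewrite (E u a).
pose ta i := a (lift ord0 i); pose tb i := b (lift ord0 i).
have wt : box_wf ta tb by move=> i; apply: wab.
have ab0 : lt (a ord0) (b ord0) by apply: wab.
suff step (Y : ('I_k.+1 -> M) -> Prop) a1 b1 : definable_vpred S Y -> subbox a1 b1 ta tb ->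
    (forall v, inbox a1 b1 v -> near_r lt (fun t => Y (env_cons t v)) (a ord0)) ->
    exists a' b', subbox a' b' a b /\ (forall u, inbox a' b' u -> Y u).
  have dnear : definable_vpred S (fun v => near_r lt (fun t => X (env_cons t v)) (a ord0)).
    by rewrite /near_r; dfn.
  have [a1 [b1 [s1 [H1|H1]]]] := IH _ ta tb dnear wt.
    by have [a' [b' [s' H']]] := step X a1 b1 dX s1 H1; exists a', b'; split=> //; left.
  have [||a' [b' [s' H']]] := step (fun u => ~ X u) a1 b1 _ s1.
  - by dfn.
  - move=> v /H1.
    by have [//|] := @near_dicho _ _ _ S _ T (fun t => X (env_cons t v)) (a ord0) ltac:(dfn).
  by exists a', b'; split=> //; right.
move=> dY s1 H1.
have [||a2 [b2 [y [z [s2 yz H2]]]]] := @uniformize k (fun v e => lt (a ord0) e /\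
    lt e (b ord0) /\ forall t, lt (a ord0) t -> lt t e -> Y (env_cons t v)) a1 b1 _ s1.1.
- by dfn.
- move=> v /H1/(near_in T ab0)[e [ae eb He]]; exists (a ord0), e; split=> //.
  move=> w aw we; do 2?split=> //; first by ord T.
  by move=> t at_ tw; apply: He => //; ord T.
have [e [ye ez]] := to_dense T yz.
have [u0 iu0] := box_point s2.1.
have [ae [eb _]] := H2 u0 e iu0 ye ez.
exists (env_cons (a ord0) a2), (env_cons e b2); split; first split.
- exact: box_wf_cons s2.1.
- move=> u; rewrite (env_consE u) => /inbox_cons[xu [ux iu]].
  rewrite (env_consE a) (env_consE b); apply/inbox_cons.
  by split=> //; split; [ord T|apply/s1.2/s2.2].
- move=> u; rewrite (env_consE u) => /inbox_cons[xu [ux iu]].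
  by have [_ [_ H]] := H2 _ e iu ye ez; apply: H.
Qed.

(** The coordinates of [v] are fixed one by one: the first coordinates that extend by a box of good
    tails contain an interval, so one of them works on a smaller box. *)
Lemma uniformize_vec k n (R : ('I_k -> M) -> ('I_n -> M) -> Prop) a b :
  definable_vfamily S R -> box_wf a b ->
  (forall u, inbox a b u -> exists p q, box_wf p q /\ forall v, inbox p q v -> R u v) ->
  exists a' b' v, subbox a' b' a b /\ forall u, inbox a' b' u -> R u v.
Proof.
elim: n R a b => [|n IH] R a b dR wab HR.
  have E (u v : 'I_0 -> M) : u = v by apply: funext => -[].
  have [u0 /HR[p _]] := box_point wab.
  by exists a, b, p; split=> // u /HR[p' [q' [_ H]]]; apply: H => -[].
pose R1 u y := exists p q : 'I_n -> M, box_wf p q /\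
  forall v, inbox p q v -> R u (env_cons y v).
have [||a1 [b1 [y [z [s1 yz H1]]]]] := @uniformize k R1 a b _ wab.
- by rewrite /R1 /box_wf /inbox; dfn.
- move=> u /HR[p [q [wpq H]]]; exists (p ord0), (q ord0).
  split=> [|w pw wq]; first exact: wpq.
  exists (fun i => p (lift ord0 i)), (fun i => q (lift ord0 i)); split=> [i|v iv].
    exact: wpq.
  by apply: H; rewrite (env_consE p) (env_consE q); apply/inbox_cons.
have [w [yw wz]] := to_dense T yz.
have [||a2 [b2 [v [s2 H2]]]] := IH (fun u v => R u (env_cons w v)) a1 b1 _ s1.1.
- by dfn.
- by move=> u iu; apply: H1.
by exists a2, b2, (env_cons w v); split=> //; apply: subbox_trans s2 s1.
Qed.

End Boxes.

(** * Open projections and relative interior *)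

Section Projections.
Context (L : language) {disp : Order.disp_t} {M : orderTopologicalType disp}.
Variables (S : structure L M) (lt : M -> M -> Prop).
Hypothesis T : tame_order S lt.
Let dl : definable_rel S lt := to_def T.

Definition over d n (s : 'I_d -> 'I_n) (x : 'I_n -> M) (u : 'I_d -> M) : Prop :=
  forall i, x (s i) = u i.

(** [s] may list the coordinates in any order, so that [env_cons] can prepend one;
    [open_proj_sorted] restores the increasing order demanded by [has_open_proj]. *)
Definition open_proj d n (s : 'I_d -> 'I_n) (X : ('I_n -> M) -> Prop) : Prop :=
  exists a b, box_wf lt a b /\
    forall u, inbox lt a b u -> exists x, X x /\ over s x u.

Definition rel_interior n (X Y : ('I_n -> M) -> Prop) (x : 'I_n -> M) : Prop :=
  exists p q, inbox lt p q x /\ forall y, X y -> inbox lt p q y -> Y y.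

Lemma open_proj_inj d n (s : 'I_d -> 'I_n) X : open_proj s X -> injective s.
Proof.
move=> [a [b [wab H]]] i j sij; apply: contrapT => ij.
have [u iu] := box_point T wab.
(* Coordinate [i] can be moved within the box away from coordinate [j], although [s i = s j] forces
   them to agree. *)
suff [z [az [zb zu]]] : exists z, lt (a i) z /\ lt z (b i) /\ z <> u j.
  have [|x [_ xu]] := H (fun k => if k == i then z else u k).
    by move=> k; case: eqP => [->|_]; [split|apply: iu].
  have xi := xu i; have xj := xu j; rewrite eqxx in xi.
  by case: eqP xj => [/esym//|_]; rewrite -sij xi.
have [uij|uij] := pselect (u i = u j).
  have [ai ib] := iu i; have [z [az zu]] := to_dense T ai.
  exists z; split=> //; split; first by ord T.
  by move=> e; rewrite -uij in e; rewrite e in zu; ord T.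
by exists (u i); have [] := iu i.
Qed.

Lemma sorting_perm d n (s : 'I_d -> 'I_n) : injective s ->
  exists r r' : 'I_d -> 'I_d, cancel r r' /\ {homo s \o r : i j / (i < j)%N}.
Proof.
move=> sI; pose l := sort (fun i j => (s i <= s j)%N) (enum 'I_d).
have sl : size l = d by rewrite size_sort size_enum_ord.
have ul : uniq l by rewrite sort_uniq enum_uniq.
have ol : sorted (fun i j => (s i <= s j)%N) l.
  by apply: sort_sorted => i j; apply: leq_total.
pose r (i : 'I_d) := nth i l i.
have rI : injective r.
  move=> i j; rewrite /r (set_nth_default j) ?sl // => /eqP.
  by rewrite nth_uniq ?sl // => /eqP/val_inj.
have [r' rK _] := injF_bij rI; exists r, r'; split=> // i j ij /=.
rewrite ltn_neqAle; apply/andP; split.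
  by apply/eqP => /val_inj/sI/rI e; rewrite e ltnn in ij.
rewrite /r (set_nth_default j) ?sl //.
apply: (sorted_ltn_nth (leT := fun i j => (s i <= s j)%N)) => //; rewrite ?inE ?sl //.
by move=> x y z; apply: leq_trans.
Qed.

Lemma open_proj_sorted d n (s : 'I_d -> 'I_n) X : open_proj s X ->
  exists s' : 'I_d -> 'I_n, {homo s' : i j / (i < j)%N} /\ open_proj s' X.
Proof.
move=> oX; have [r [r' [rK hr]]] := sorting_perm (open_proj_inj oX).
have r'K : cancel r' r by exact: canF_sym rK.
exists (s \o r); split=> //; have [a [b [wab H]]] := oX.
exists (a \o r), (b \o r); split=> [i|u iu]; first exact: wab.
have [|x [Xx xu]] := H (u \o r').
  by move=> i; have := iu (r' i); rewrite /= r'K.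
by exists x; split=> // i; rewrite /= xu /= rK.
Qed.

(** The last hypothesis says that each [P i] is dense in the box, so a sub-box given by
    [box_dichotomy] cannot avoid it. The box is shrunk once per element of the list. *)
Lemma generic_all k (I : eqType) (P : I -> ('I_k -> M) -> Prop) (l : seq I) a b :
  (forall i, definable_vpred S (P i)) -> box_wf lt a b ->
  (forall i a' b', subbox lt a' b' a b -> exists2 u, inbox lt a' b' u & P i u) ->
  exists a' b', subbox lt a' b' a b /\ forall u i, i \in l -> inbox lt a' b' u -> P i u.
Proof.
move=> dP wab H; elim: l => [|i l [a1 [b1 [s1 H1]]]].
  by exists a, b; split=> // u i; rewrite in_nil.
have [a2 [b2 [s2 H2]]] := box_dichotomy T (dP i) s1.1.
have s21 := subbox_trans s2 s1.
exists a2, b2; split=> // u j; rewrite inE => /orP[/eqP->|jl] iu; last first.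
  by apply: H1 => //; apply: s2.2.
case: H2 => [|H2]; first exact.
by have [w /H2] := H i a2 b2 s21.
Qed.

(* If no fibre coordinate sweeps out an interval then generically the fibre of
   X is discrete; a box isolating a point of Y in its fibre can be chosen
   uniformly, and then Y fills X in that box. *)
Lemma open_proj_rel_interior d n (s : 'I_d -> 'I_n) (X Y : ('I_n -> M) -> Prop) :
  definable_vpred S X -> definable_vpred S Y -> (forall x, Y x -> X x) -> open_proj s Y ->
  (forall j, ~ open_proj (env_cons j s) X) ->
  exists x, Y x /\ rel_interior X Y x.
Proof.
move=> dX dY YX oY noX; have sI := open_proj_inj oY.
have [a [b [wab H]]] := oY.
pose W j u y := exists x, X x /\ over s x u /\ x j = y.
have dW j : definable_family S (W j) by rewrite /W /over; dfn.
(* The j-th coordinates of the fibre over [u] have no interior. If this failed throughout a sub-box,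
   [uniformize] would contradict [noX]. *)
pose P j u := ~ exists y z, lt y z /\ forall w, lt y w -> lt w z -> W j u w.
have dP j : definable_vpred S (P j) by have := dW j; rewrite /P => dWj; dfn.
have [|a1 [b1 [s1 H1]]] := @generic_all _ _ P (enum 'I_n) a b dP wab.
  move=> j a' b' s'; apply: contrapT => nP; apply: (noX j).
  have [|a2 [b2 [y [z [s2 yz H2]]]]] := uniformize T (dW j) s'.1.
    move=> u iu; apply: contrapT => nu; apply: nP; by exists u.
  exists (env_cons y a2), (env_cons z b2); split; first exact: box_wf_cons s2.1.
  move=> u; rewrite (env_consE u) => /inbox_cons[yu [uz iu]].
  have [x [Xx [xu xj]]] := H2 _ _ iu yu uz; exists x; split=> // i.
  case: (unliftP ord0 i) => [k ->|->]; last by rewrite !env_cons0.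
  by rewrite !env_cons_lift xu.
have {}H1 u j : inbox lt a1 b1 u -> P j u by apply: H1; rewrite mem_enum.
(* The box from [p] to [q] isolates a point of Y in the fibre of X over [u]. Good lower corners fill
   a box, and so do good upper corners, so each in turn is made constant. *)
pose A u p q := exists z, Y z /\ over s z u /\ inbox lt p q z /\
  forall x, X x -> over s x u -> inbox lt p q x -> forall j, x j = z j.
have T' := tame_rev T.
have [||a2 [b2 [p [s2 H2]]]] :=
    @uniformize_vec _ _ _ _ _ T d n (fun u p => exists q, A u p q) a1 b1 _ s1.1.
- by rewrite /A /over /inbox; dfn.
- move=> u iu; have [z [Yz zu]] := H u (s1.2 u iu).
  have /choice[p0 /choice[q0 pq]] j : exists p q, lt p (z j) /\ lt (z j) q /\
      forall w, lt p w -> lt w q -> W j u w -> w = z j.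
    have dWj : definable_pred S (W j u) by have := dW j; dfn.
    have [[e [? He]]|[q [zq Hq]]] := near_dicho T (z j) dWj.
      by case: (H1 u j iu); exists (z j), e.
    have [[e [? He]]|[p [pz Hp]]] := near_dicho T' (z j) dWj.
      by case: (H1 u j iu); exists e, (z j); split=> // w *; apply: He.
    exists p, q; do 2!split=> //; move=> w pw wq Ww.
    have [wz|[//|zw]] := to_total T w (z j); first by case: (Hp w).
    by case: (Hq w).
  exists p0, z; split=> [j|v iv]; first by have [] := pq j.
  exists q0, z; do 2!split=> //; split=> [j|x Xx xu ix j].
    by have [_ ?] := iv j; have [_ []] := pq j.
  have [pj [zj Hj]] := pq j; have [pv vz] := iv j; have [vx xq] := ix j.
  by apply: Hj; [ord T|ord T|exists x].
have [||a3 [b3 [q [s3 H3]]]] :=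
    @uniformize_vec _ _ _ _ _ T d n (fun u q => A u p q) a2 b2 _ s2.1.
- by rewrite /A /over /inbox; dfn.
- move=> u iu; have [q0 [z [Yz [zu [iz Hz]]]]] := H2 u iu.
  exists z, q0; split=> [j|v iv]; first by have [] := iz j.
  exists z; do 2!split=> //; split=> [j|x Xx xu ix j].
    by have [? _] := iv j; have [? _] := iz j.
  apply: Hz => // i; have [? ?] := ix i; have [? ?] := iv i.
  by split=> //; ord T.
have [u iu] := box_point T s3.1.
have [z [Yz [zu [iz _]]]] := H3 u iu.
exists z; split=> //.
(* The box from [lo] to [hi] lies in the isolating box and projects by [s] into the box of good
   parameters. *)
have /choice[lo /choice[hi Hlh]] j : exists lo hi, lt lo (z j) /\ lt (z j) hi /\
    forall w, lt lo w -> lt w hi -> lt (p j) w /\ lt w (q j) /\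
      forall i, s i = j -> lt (a3 i) w /\ lt w (b3 i).
  have [pz zq] := iz j.
  have [[i si]|ni] := pselect (exists i, s i = j); last first.
    exists (p j), (q j); do 2!split=> //; move=> w ? ?; do 2!split=> //.
    by move=> i si; case: ni; exists i.
  have [az zb] := iu i; rewrite -zu si in az zb.
  have [lo [zlo lop loa]] := between2 T' pz az.
  have [hi [zhi hiq hib]] := between2 T zq zb.
  rewrite /rev_lt in zlo lop loa.
  exists lo, hi; do 2!split=> //; move=> w low whi.
  split; [ord T|split; [ord T|move=> i']].
  by rewrite -si => /sI ->; split; ord T.
exists lo, hi; split=> [j|x Xx ix]; first by have [? []] := Hlh j.
have ix3 : inbox lt a3 b3 (fun i => x (s i)).
  move=> i; have [xl xh] := ix (s i); have [_ [_ Hw]] := Hlh (s i).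
  by have [_ [_]] := Hw _ xl xh; apply.
(* The fibre through [x] meets the isolating box only in a point of Y, which is therefore [x]
   itself. *)
have [z' [Yz' [zu' [_ Hz']]]] := H3 _ ix3.
suff -> : x = z' by [].
apply: funext => j; apply: Hz' => // i.
have [xl xh] := ix i; have [_ [_ Hw]] := Hlh i.
by have [? []] := Hw _ xl xh.
Qed.

Lemma open_proj_hyperplane d n (s : 'I_d.+1 -> 'I_n) (X : ('I_n -> M) -> Prop) :
  definable_vpred S X -> open_proj s X ->
  exists (Y : ('I_n -> M) -> Prop),
    [/\ definable_vpred S Y /\ (forall x, Y x -> X x),
        forall x, X x -> ~ Y x -> rel_interior X (fun y => ~ Y y) x,
        forall x, Y x -> ~ rel_interior X Y x &
        open_proj (fun i => s (lift ord0 i)) Y].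
Proof.
move=> dX [a [b [wab H]]].
pose i0 := s ord0.
(* At a point of the hyperplane x_i0 = c, this is interiority in X of the hyperplane section. *)
pose Z x := rel_interior X (fun y => y i0 = x i0) x.
have dZ : definable_vpred S Z by rewrite /Z /rel_interior /inbox; dfn.
have [|a1 [b1 [s1 H1]]] := @box_dichotomy _ _ _ _ _ T _
  (fun u => exists x, X x /\ over s x u /\ Z x) a b _ wab.
  by rewrite /over; dfn.
case: H1 => H1.
  (* If every fibre over a box contained such a point, one box from [p] to [q] would witness it for
     all parameters; two parameters with different first coordinates then give points of X in this
     box that differ at [i0]. *)
  exfalso.
  pose A u p q := exists x, X x /\ over s x u /\ inbox lt p q x /\
    forall y, X y -> inbox lt p q y -> y i0 = x i0.
  have [||a2 [b2 [p [s2 H2]]]] :=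
    @uniformize_vec _ _ _ _ _ T _ n (fun u p => exists q, A u p q) a1 b1 _ s1.1.
  - by rewrite /A /over /inbox; dfn.
  - move=> u iu; have [x [Xx [xu [p0 [q0 [ix Hx]]]]]] := H1 u iu.
    exists p0, x; split=> [j|v iv]; first by have [] := ix j.
    exists q0, x; do 2!split=> //; split=> [j|y Xy iy].
      by have [_ ?] := iv j; have [_ ?] := ix j.
    apply: Hx => // j; have [? ?] := iy j; have [? ?] := iv j.
    by split=> //; ord T.
  have [||a3 [b3 [q [s3 H3]]]] :=
    @uniformize_vec _ _ _ _ _ T _ n (fun u q => A u p q) a2 b2 _ s2.1.
  - by rewrite /A /over /inbox; dfn.
  - move=> u iu; have [q0 [x [Xx [xu [ix Hx]]]]] := H2 u iu.
    exists x, q0; split=> [j|v iv]; first by have [] := ix j.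
    exists x; do 2!split=> //; split=> [j|y Xy iy].
      by have [? _] := iv j; have [? _] := ix j.
    apply: Hx => // j; have [? ?] := iy j; have [? ?] := iv j.
    by split=> //; ord T.
  have [u iu] := box_point T s3.1.
  have [a0 b0] := iu ord0; have [t [t1 t2]] := to_dense T a0.
  have [|x' [Xx' [xu' [ix' _]]]] := H3 (env_cons t (fun i => u (lift ord0 i))).
    move=> i; case: (unliftP ord0 i) => [j ->|->]; rewrite ?env_cons_lift ?env_cons0 //.
    by split=> //; ord T.
  have [x [Xx [xu [ix Hx]]]] := H3 u iu.
  have := Hx x' Xx' ix'; rewrite xu xu' env_cons0 => e; rewrite e in t2.
  by ord T.
(* No point of X over this sub-box lies in [Z], so for any [c] in its first side, removing [Z]
   leaves the section over the sub-box intact. *)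
have wab0 := s1.1 ord0; have [c [ac cb]] := to_dense T wab0.
pose Y x := X x /\ x i0 = c /\ ~ Z x.
exists Y; split.
- by split=> [|x []//]; rewrite /Y; dfn.
- move=> x Xx nY.
  (* [Z] is open in X, and a point off the hyperplane has a box that misses it. *)
  have [xc|xc] := pselect (x i0 = c).
    have [p [q [ix Hx]]] : Z x.
      by apply: contrapT => nZ; apply: nY.
    exists p, q; split=> // y Xy iy [_ [yc nZ]]; apply: nZ.
    by exists p, q; split=> // z Xz iz; rewrite yc -xc; apply: Hx.
  have /choice[p /choice[q Hpq]] j : exists p q, lt p (x j) /\ lt (x j) q /\
      (j = i0 -> forall w, lt p w -> lt w q -> w <> c).
    have [p px] := to_below T (x j); have [q xq] := to_above T (x j).
    have [ji|ji] := pselect (j = i0); last by exists p, q.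
    rewrite ji in px xq *; have [xc'|[//|xc']] := to_total T (x i0) c.
      by exists p, c; do 2!split=> //; move=> _ w _ wc e; rewrite e in wc; ord T.
    by exists c, q; do 2!split=> //; move=> _ w cw _ e; rewrite e in cw; ord T.
  exists p, q; split=> [j|y Xy iy [_ [yc _]]]; first by have [? []] := Hpq j.
  have [_ [_ Hc]] := Hpq i0; have [? ?] := iy i0.
  by apply: (Hc erefl (y i0)).
- move=> x [Xx [xc nZ]] [p [q [ix Hx]]]; apply: nZ.
  by exists p, q; split=> // y Xy iy; have [_ [-> _]] := Hx y Xy iy.
exists (fun i => a1 (lift ord0 i)), (fun i => b1 (lift ord0 i)).
split=> [i|v iv]; first exact: s1.1.
have icv : inbox lt a1 b1 (env_cons c v).
  by rewrite (env_consE a1) (env_consE b1); apply/inbox_cons.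
have [x [Xx xu]] := H _ (s1.2 _ icv).
exists x; split; last by move=> i; rewrite xu env_cons_lift.
split=> //; split; first by rewrite xu env_cons0.
by move=> Zx; apply: (H1 _ icv); exists x.
Qed.
End Projections.

(** * Topology and dimension rank *)

Section Topology.
Context {disp : Order.disp_t} {M : orderTopologicalType disp}.
Hypothesis hdlo : DLO_without_endpoints M.

Let lt (x y : M) : Prop := x < y.

Lemma nbhs_itv (x : M) (N : set M) :
  nbhs x N <-> exists p q, p < x /\ x < q /\ forall w, p < w -> w < q -> N w.
Proof.
rewrite itv_nbhsE; split=> [[[l r] [oi xi] sN]|[p [q [px [xq sN]]]]].
  have [[p px] [q xq]] := hdlo.2 x.
  move: l r oi xi sN => [[]y|[]] [[]z|[]] //= _; rewrite in_itv /= => xi sN.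
  - have /andP[yx xz] := xi; exists y, z; do 2!split=> //; move=> w yw wz.
    by apply: sN; rewrite /= in_itv /= yw wz.
  - have /andP[yx _] := xi; exists y, q; do 2!split=> //; move=> w yw wz.
    by apply: sN; rewrite /= in_itv /= yw.
  - exists p, z; do 2!split=> //; move=> w yw wz.
    by apply: sN; rewrite /= in_itv /= wz.
  - by exists p, q; do 2!split=> //; move=> w yw wz; apply: sN.
exists (Interval (BRight p) (BLeft q)); first by split=> //; rewrite in_itv /= px xq.
by move=> w /=; rewrite in_itv /= => /andP[]; apply: sN.
Qed.

Lemma nbhs_box n (x : cart M n) (N : set (cart M n)) :
  nbhs x N <-> exists p q, inbox lt p q x /\ forall y, inbox lt p q y -> N y.
Proof.
split=> [xN|[p [q [ix sN]]]].
  (* The boxes around [x] form a filter, whose convergence to [x] is checked one coordinate at a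
     time by [cvg_sup], the other sides being arbitrary. *)
  pose F : set_system (cart M n) := filter_from
    [set pq : cart M n * cart M n | inbox lt pq.1 pq.2 x]
    (fun pq => inbox lt pq.1 pq.2).
  have FF : Filter F.
    apply: filter_from_filter.
      have /choice[p /choice[q H]] i : exists p q, lt p (x i) /\ lt (x i) q.
        by have [[p px] [q xq]] := hdlo.2 (x i); exists p, q.
      by exists (p, q).
    move=> [p q] [p' q'] /= i1 i2.
    exists (fun i => Order.max (p i) (p' i), fun i => Order.min (q i) (q' i)) => /=.
      move=> i; have [? ?] := i1 i; have [? ?] := i2 i.
      by rewrite /lt gt_max lt_min; split; apply/andP.
    move=> y iy; split=> i; have [] := iy i; rewrite /lt /= gt_max lt_min => /andP[? ?] /andP[? ?] //.
  suff : F --> x by move=> /(_ _ xN)[[p q] /= ix sN]; exists p, q.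
  apply/cvg_sup => i A.
  rewrite nbhsE => -[_ [[B oB <-] /= Bx] sBA].
  have /nbhs_itv[p [q [px [xq sB]]]] : nbhs (x i) B by apply: open_nbhs_nbhs.
  have /choice[p0 /choice[q0 H]] j : exists p0 q0, lt p0 (x j) /\ lt (x j) q0 /\
      (j = i -> p0 = p /\ q0 = q).
    have [->|ji] := eqVneq j i; first by exists p, q.
    have [[p1 p1x] [q1 xq1]] := hdlo.2 (x j); exists p1, q1; do 2!split=> //.
    by move=> e; rewrite e eqxx in ji.
  exists (p0, q0) => [j|y /(_ i) /=]; first by have [? []] := H j.
  have [_ [_ [//|-> ->]]] := H i => -[py yq].
  by apply: sBA => /=; apply: sB.
have FF : Filter (nbhs x) by exact: (@nbhs_filter (cart M n) x).
suff H : nbhs x (inbox lt p q : set (cart M n)) by exact: (@filterS _ (nbhs x) FF _ _ sN H).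
apply: (@filter_forall _ 'I_n (fun i (y : cart M n) => lt (p i) (y i) /\ lt (y i) (q i)) _ FF) => i.
have := @proj_continuous 'I_n (fun=> M) i x (fun w => lt (p i) w /\ lt w (q i)).
apply; apply/nbhs_itv; have [? ?] := ix i.
by exists (p i), (q i); split.
Qed.

Lemma inbox_wf n (p q x : 'I_n -> M) : inbox lt p q x -> box_wf lt p q.
Proof. by move=> ix i; have [px xq] := ix i; apply: lt_trans px xq. Qed.

Lemma has_open_projP n (X : set (cart M n)) d : has_open_proj X d <->
  exists s : 'I_d -> 'I_n, {homo s : i j / (i < j)%N} /\ open_proj lt s X.
Proof.
split=> -[s [hs]].
  move=> [u /nbhs_box[p [q [iu sX]]]]; exists s; split=> //.
  exists p, q; split=> [|v /sX[x Xx <-]]; first exact: inbox_wf iu.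
  by exists x; split.
move=> [a [b [wab H]]]; exists s; split=> //.
have [u iu] : exists u, inbox lt a b u.
  have /choice[u H'] i : exists z, lt (a i) z /\ lt z (b i).
    by have [z /andP[? ?]] := hdlo.1 _ _ (wab i); exists z.
  by exists u.
exists u; apply/nbhs_box; exists a, b; split=> // v /H[x [Xx xv]].
by exists x => //; apply: funext => i; apply: xv.
Qed.

Lemma nbhs_sub n (X N : set (cart M n)) (x : cart M n) : X x ->
  @nbhs _ (subspace X) x N <-> rel_interior lt X N x.
Proof.
move=> Xx; have -> : @nbhs _ (subspace X) x = within X (nbhs x).
  by have E := nbhs_subspace_in Xx; symmetry; exact E.
split=> [/nbhs_box[p [q [ix H]]]|[p [q [ix H]]]].
  by exists p, q; split=> // y Xy iy; apply: H.
by apply/nbhs_box; exists p, q; split=> // y iy Xy; apply: H.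
Qed.

(** [subspace X] keeps the full carrier and isolates the points outside X, so in [closed_in] they
    impose no condition. *)
Lemma nbhs_sub_out n (X N : set (cart M n)) (x : cart M n) : ~ X x -> N x ->
  @nbhs _ (subspace X) x N.
Proof.
move=> nXx Nx; have -> : @nbhs _ (subspace X) x = globally [set x].
  by have E := nbhs_subspace_out nXx; symmetry; exact E.
by move=> _ ->.
Qed.

Lemma closed_in n (X Y : set (cart M n)) :
  (forall x, X x -> ~ Y x -> rel_interior lt X (fun y => ~ Y y) x) ->
  @closed (subspace X) Y.
Proof.
move=> H; rewrite -openC openE => x nYx.
have [Xx|nXx] := pselect (X x); first by apply/nbhs_sub => //; apply: H.
exact: nbhs_sub_out.
Qed.

Lemma interior_inP n (X Y : set (cart M n)) : Y `<=` X ->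
  @interior (subspace X) Y = set0 <-> forall x, Y x -> ~ rel_interior lt X Y x.
Proof.
move=> YX; split=> [Y0 x Yx iYx|H].
  suff : @interior (subspace X) Y x by rewrite Y0.
  by apply/nbhs_sub => //; apply: YX.
apply/seteqP; split=> // x Yx.
have Yx' := @interior_subset (subspace X) Y x Yx.
by apply: (H x Yx'); apply/nbhs_sub => //; apply: YX.
Qed.
End Topology.

(** * Comparison of ordinal trees *)

Lemma ole_refl a : ole a a.
Proof. by elim: a => I f IH /= i; exists i. Qed.

Lemma ole0 a : ole ozero a.
Proof. by case: a => I f []. Qed.

Lemma ole_trans b a c : ole a b -> ole b c -> ole a c.
Proof.
elim: a b c => I f IH [J g] [K h] /= ab bc i.
by have [j fg] := ab i; have [k gh] := bc j; exists k; apply: IH fg gh.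
Qed.

Lemma ole_or_olt a b : ole a b \/ olt b a.
Proof.
elim: a b => I f IH [J g] /=.
have [|H] := pselect (forall i, exists j, ole (f i) (g j)); first by left.
right; apply: contrapT => nH; apply: H => i; apply: contrapT => nj.
apply: nH; exists i; move: nj (IH i); case: (f i) => K h nj Ki j.
by have [fg|] := Ki (g j); first by case: nj; exists j.
Qed.

(** If strictness failed, [a] would be equivalent to zero or to a successor. *)
Lemma olt_onat_limit k a : olimit a -> ole (onat k) a -> olt (onat k) a.
Proof.
move=> [a0 aS] ka; have [ak|//] := ole_or_olt a (onat k).
by case: k ka ak => [|k] ka ak; [case: a0|case: (aS (onat k))].
Qed.

(** * Comparison of dimension and dimension rank *)

Section DimensionRank.
Context (L : language) (disp : Order.disp_t) (M : orderTopologicalType disp).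
Variable S : structure L M.
Hypotheses (hdlo : DLO_without_endpoints M) (hcomplete : definably_complete S)
  (hlocal : locally_o_minimal S).

Let T := tame_lt hdlo hcomplete hlocal.

Lemma has_open_proj0 n (X : set (cart M n)) : X !=set0 <-> has_open_proj X 0.
Proof.
split=> [[x Xx]|[s [_ [u /interior_subset[x Xx _]]]]]; last by exists x.
have E (u v : 'I_0 -> M) : u = v by apply: funext => -[].
have s : 'I_0 -> 'I_n by case.
apply/(has_open_projP hdlo); exists s; split; first by case.
exists (fun i => x (s i)), (fun i => x (s i)); split=> [[]//|u _].
by exists x; split=> // -[].
Qed.

Lemma has_open_proj_leq n (X : set (cart M n)) d : has_open_proj X d -> (d <= n)%N.
Proof.
move=> [s [hs _]]; have sI : injective s.
  move=> i j sij; apply: val_inj.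
  by case: (ltngtP i j) => // /hs; rewrite sij ltnn.
by have := leq_card s sI; rewrite !card_ord.
Qed.

(** Otherwise no coordinate could be added to [s], and [open_proj_rel_interior] would give a point
    of Y interior in X. *)
Lemma has_open_proj_nowhere_dense n (X Y : set (cart M n)) d :
  definable S X -> definable S Y -> Y `<=` X ->
  @interior (subspace X) Y = set0 -> has_open_proj Y d -> has_open_proj X d.+1.
Proof.
move=> dX dY YX /(interior_inP hdlo YX) Y0 /(has_open_projP hdlo)[s [hs oY]].
apply: contrapT => nX.
have [|x [Yx iYx]] := open_proj_rel_interior T
  (definable_definable_vpred dX) (definable_definable_vpred dY) YX oY; last exact: (Y0 x).
by move=> j /(open_proj_sorted T)[s' ?]; apply: nX; apply/(has_open_projP hdlo); exists s'.
Qed.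

Lemma has_open_proj_section n (X : set (cart M n)) d :
  definable S X -> has_open_proj X d.+1 ->
  exists Y : set (cart M n), [/\ definable S Y, Y `<=` X,
    @closed (subspace X) Y, @interior (subspace X) Y = set0 & has_open_proj Y d].
Proof.
move=> dX /(has_open_projP hdlo)[s [hs oX]].
have [Y [[dY YX] cY iY oY]] := open_proj_hyperplane T (definable_definable_vpred dX) oX.
have [a _] := oX; exists Y; split=> //.
- exact: definable_vpred_definable (a ord0) dY.
- exact: closed_in.
- exact/interior_inP.
- apply/(has_open_projP hdlo); exists (fun i => s (lift ord0 i)); split=> // i j ij.
  by apply: hs; rewrite !lift0.
Qed.

(** Induction on the derivation. At a limit ordinal the finite [k] lies strictly below [a]; at a
    successor the dimension found for Y increases by one. Asking for some d >= k covers k = 0, where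
    [k.-1] truncates. *)
Lemma drank_ge_has_open_proj n (X : set (cart M n)) a k :
  drank_ge S a X -> definable S X -> ole (onat k) a ->
  exists2 d, (k <= d)%N & has_open_proj X d.
Proof.
move=> H; elim: H k => {a X} [a X a0 X0|a X la _ IH|a b X Y ab dY YX _ Y0 _ IH] k dX ka.
- case: k ka => [_|k ka]; first by exists 0%N => //; apply/has_open_proj0.
  by have /= /(_ tt)[[]] := ole_trans ka a0.1.
- by apply: (IH (onat k)) => //; [apply: olt_onat_limit|apply: ole_refl].
have [|d kd oY] := IH k.-1 dY.
  case: k ka => [_|k ka]; first exact: ole0.
  by have /= /(_ tt)[] := ole_trans ka ab.1.
exists d.+1; first by case: k kd {ka}.
exact: has_open_proj_nowhere_dense oY.
Qed.

Lemma has_open_proj_drank_ge n (X : set (cart M n)) d :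
  definable S X -> has_open_proj X d -> drank_ge S (onat d) X.
Proof.
elim: d X => [|d IH] X dX oX.
  by apply: drank_ge_zero; [split|apply/has_open_proj0].
have [Y [dY YX cY Y0 oY]] := has_open_proj_section dX oX.
apply: drank_ge_succ dY YX cY Y0 (IH Y dY oY).
by split; apply: ole_refl.
Qed.

End DimensionRank.

Theorem proposition4p3 (L : language) (disp : Order.disp_t)
    (M : orderTopologicalType disp) (S : structure L M)
    (hdlo : DLO_without_endpoints M)
    (hcomplete : definably_complete S)
    (hlocal : locally_o_minimal S)
    (n : nat) (X : set (cart M n)) (hX : definable S X) :
  drank_is S X (xord_of_dim (dim X)).
Proof.
rewrite /dim; case: asboolP => X0 /=; last first.
  by apply/seteqP; split=> // x Xx; case: X0; exists x.
pose P (d : 'I_n.+1) := `[< has_open_proj X d >].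
have P0 : P ord0 by apply/asboolP/(has_open_proj0 hdlo).
have [d Pd maxd] : {d | P d & (\max_(d < n.+1 | P d) d)%N = d}.
  by apply: eq_bigmax_cond; apply/card_gt0P; exists ord0.
rewrite maxd; split; first by apply: has_open_proj_drank_ge => //; apply/asboolP.
(* Rank at least d+1 would yield an open projection onto M^k with k > d, against the maximality of
   [d]. *)
move=> /(drank_ge_has_open_proj hdlo hcomplete hlocal)/(_ hX (ole_refl (onat d.+1))).
move=> [k dk oX]; have kn := has_open_proj_leq oX.
have := @leq_bigmax_cond _ P (fun i => i : nat) (Ordinal (kn : (k < n.+1)%N)).
by rewrite maxd /= leqNgt dk => /(_ (introT (asboolP _) oX)).
Qed.
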